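(* Suppose the spin system has SSM. Then there is a constant $c>0$ such that for every $d$-dimensional cube $V\subset\mathbb{Z}^d$ and every boundary condition $\psi$ on $\partial V$, the matrix $S(EOE)=K_{V_{\rm e}}K_{V_{\rm o}}K_{V_{\rm e}}$ satisfies $\lambda(S(EOE))\ge c$. Consequently the relaxation time $\tau_{\rm rel}=\big(1-\sqrt{1-\lambda(S(EOE))}\big)^{-1}$ of the (non-reversible) alternating scan dynamics, which first updates all even vertices and then all odd vertices by single-site heat-bath updates, is $O(1)$.
   Context: Spin system on $\mathbb{Z}^d$: spins $\{1,\dots,q\}$, symmetric nearest-neighbor edge potential $U$ (values in $\mathbb{R}\cup\{-\infty\}$), vertex potential $W$; Gibbs distribution $\mu=\mu^\psi$ on finite $V$ with boundary condition $\psi$ on part of the outer boundary $\partial V$; permissive, with the single-site heat-bath Glauber dynamics irreducible on the set $\Omega$ of valid configurations. SSM: there exist $a,b>0$ such that for every $d$-dimensional cube $\Lambda$, all $B\subseteq\Lambda$, all $u\in\partial\Lambda$ and all boundary conditions $\psi,\psi_u$ on $\partial\Lambda$ differing only at $u$, $\|\mu^\psi_B-\mu^{\psi_u}_B\|_{TV}\le b\,e^{-a\,\mathrm{dist}(u,B)}$ (marginals on $B$, $\ell_1$ distance). $V_{\rm e}$, $V_{\rm o}$: vertices of $V$ with even, resp. odd, coordinate sum. For $A\subseteq V$, $K_A(\sigma,\sigma')=\mathbf 1(\sigma(V\setminus A)=\sigma'(V\setminus A))\,\mu(\sigma'(A)\mid\sigma(V\setminus A))$. $S(EOE)$ is reversible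 w.r.t. $\mu$; $\lambda(P)=1-\max\{|\lambda_2|,|\lambda_N|\}$ for reversible $P$ with eigenvalues $1=\lambda_1\ge\dots\ge\lambda_N$. *)

(* Defs.v *)
From HB Require Import structures.
From mathcomp Require Import all_boot.
From mathcomp Require Import ssralg ssrint.
From Stdlib Require Import Reals.

Set Implicit Arguments.
Unset Strict Implicit.
Unset Printing Implicit Defensive.

Definition Zd (d : nat) := {ffun 'I_d -> int}.

Definition vadd d (x y : Zd d) : Zd d := [ffun j => GRing.add (x j) (y j)].

Definition unitv d (i : 'I_d) (b : bool) : Zd d :=
  [ffun j => if j == i then (if b then Posz 1 else Negz 0) else Posz 0].

Definition nbr d (x : Zd d) (i : 'I_d) (b : bool) : Zd d := vadd x (unitv i b).

Definition l1dist d (x y : Zd d) : nat :=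
  (\sum_(i < d) absz (GRing.add (x i) (GRing.opp (y i))))%nat.

Definition odd_vertex d (x : Zd d) : bool :=
  odd (absz (\big[GRing.add/Posz 0]_(i < d) x i)).

Definition in_bdry d (V : seq (Zd d)) (u : Zd d) : bool :=
  (u \notin V) && has (fun v => l1dist u v == 1%nat) V.

Definition cube d (a : Zd d) (L : nat) : seq (Zd d) :=
  [seq vadd a [ffun i => Posz (nat_of_ord (x i))] | x : {ffun 'I_d -> 'I_L}].

Definition Config d (V : seq (Zd d)) (q : nat) := {ffun seq_sub V -> 'I_q}.

Local Open Scope R_scope.

Definition posb (x : R) : bool := if Rlt_dec 0 x then true else false.

(** edge potential U with values in R u {-oo} (None = -oo); weight exp U *)
Definition ew q (U : 'I_q -> 'I_q -> option R) (s t : 'I_q) : R :=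
  match U s t with Some x => exp x | None => 0 end.

Definition bfac q (U : 'I_q -> 'I_q -> option R) (s : 'I_q) (o : option 'I_q) : R :=
  match o with Some t => ew U s t | None => 1 end.

Definition ext d q (V : seq (Zd d)) (psi : Zd d -> option 'I_q)
  (sigma : Config V q) (x : Zd d) : option 'I_q :=
  match (insub x : option (seq_sub V)) with
  | Some v => Some (sigma v) | None => psi x end.

(** unnormalised Gibbs weight exp(sum of edge and vertex potentials); every
    edge {v, v+e_i} inside V is counted once, every edge from V to the
    boundary is counted once (and only if psi is defined there). *)
Definition gweight d q (U : 'I_q -> 'I_q -> option R) (W : 'I_q -> R)
  (V : seq (Zd d)) (psi : Zd d -> option 'I_q) (sigma : Config V q) : R :=
  \big[Rmult/1]_(v : seq_sub V)
    (exp (W (sigma v)) *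
     \big[Rmult/1]_(i < d)
       (bfac U (sigma v) (ext psi sigma (nbr (val v) i true)) *
        (if nbr (val v) i false \in V then 1
         else bfac U (sigma v) (psi (nbr (val v) i false))))).

Definition valid d q U W (V : seq (Zd d)) psi : pred (Config V q) :=
  fun sigma => posb (@gweight d q U W V psi sigma).

Definition Zpart d q U W (V : seq (Zd d)) psi : R :=
  \big[Rplus/0]_(sigma : Config V q) @gweight d q U W V psi sigma.

Definition gibbs d q U W (V : seq (Zd d)) psi (sigma : Config V q) : R :=
  @gweight d q U W V psi sigma / Zpart U W V psi.

Definition agree_off d q (V : seq (Zd d)) (A : {set seq_sub V})
  (s t : Config V q) : bool :=
  [forall v, (v \notin A) ==> (s v == t v)].

(** K_A(s,t) = 1(s, t agree off A) * mu(t(A) | s(V \ A)) *)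
Definition Kmat d q U W (V : seq (Zd d)) psi (A : {set seq_sub V})
  (s t : Config V q) : R :=
  if agree_off A s t then
    @gweight d q U W V psi t /
    \big[Rplus/0]_(r : Config V q | agree_off A s r) @gweight d q U W V psi r
  else 0.

Definition mprod d q U W (V : seq (Zd d)) psi
  (P Q : Config V q -> Config V q -> R) (s t : Config V q) : R :=
  \big[Rplus/0]_(u : Config V q | valid U W psi u) (P s u * Q u t).

Definition Veven d (V : seq (Zd d)) : {set seq_sub V} :=
  [set v : seq_sub V | ~~ odd_vertex (val v)].
Definition Vodd d (V : seq (Zd d)) : {set seq_sub V} :=
  [set v : seq_sub V | odd_vertex (val v)].

Definition SEOE d q U W (V : seq (Zd d)) psi : Config V q -> Config V q -> R :=
  @mprod d q U W V psi
    (@mprod d q U W V psi (Kmat U W psi (Veven V)) (Kmat U W psi (Vodd V)))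
    (Kmat U W psi (Veven V)).

(** (N, l, f) is a complete eigen-decomposition of the matrix P on Omega:
    N = |Omega|, eigenvalues lambda_{i+1} = l i sorted non-increasingly,
    f 0, ..., f (N-1) linearly independent eigenvectors (functions on Omega). *)
Definition eigendecomp d q (V : seq (Zd d)) (Omega : pred (Config V q))
  (P : Config V q -> Config V q -> R) (N : nat) (l : nat -> R)
  (f : nat -> Config V q -> R) : Prop :=
  N = #|Omega| /\
  (forall i j : nat, (i <= j < N)%nat -> l j <= l i) /\
  (forall i : nat, (i < N)%nat -> forall s, Omega s ->
     \big[Rplus/0]_(t | Omega t) (P s t * f i t) = l i * f i s) /\
  (forall a : nat -> R,
     (forall s, Omega s -> \big[Rplus/0]_(i < N) (a i * f i s) = 0) ->
     forall i : nat, (i < N)%nat -> a i = 0).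

Definition gap (N : nat) (l : nat -> R) : R :=
  if (2 <= N)%nat then 1 - Rmax (Rabs (l 1%nat)) (Rabs (l (N - 1)%nat)) else 1.

Definition permissive d q U W : Prop :=
  forall (V : seq (Zd d)) (psi : Zd d -> option 'I_q),
    exists sigma : Config V q, 0 < @gweight d q U W V psi sigma.

Definition glauber_irreducible d q U W : Prop :=
  forall (V : seq (Zd d)) (psi : Zd d -> option 'I_q) (s t : Config V q),
    valid U W psi s -> valid U W psi t ->
    connect (fun s' t' : Config V q =>
               [exists v, posb (Kmat U W psi [set v] s' t')]) s t.

Definition marg d q U W (V : seq (Zd d)) psi (B : {set seq_sub V})
  (rho : {ffun {x : seq_sub V | x \in B} -> 'I_q}) : R :=
  \big[Rplus/0]_(sigma : Config V q | [forall x, sigma (val x) == rho x])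
     @gibbs d q U W V psi sigma.

Definition marg_l1 d q U W (V : seq (Zd d)) psi psi' (B : {set seq_sub V}) : R :=
  \big[Rplus/0]_(rho : {ffun {x : seq_sub V | x \in B} -> 'I_q})
     Rabs (@marg d q U W V psi B rho - @marg d q U W V psi' B rho).

(** strong spatial mixing; "b e^{-a dist(u,B)}" is expressed as: for every
    k <= dist(u,B) the bound b e^{-a k} holds (equivalent, and covers B = {}). *)
Definition SSM d q U W : Prop :=
  exists a b : R, 0 < a /\ 0 < b /\
  forall (c : Zd d) (L : nat), (0 < L)%nat ->
  forall (B : {set seq_sub (cube c L)}) (u : Zd d), in_bdry (cube c L) u ->
  forall eta eta' : Zd d -> 'I_q,
    (forall x, in_bdry (cube c L) x -> x <> u -> eta x = eta' x) ->
  forall k : nat, (forall x : seq_sub (cube c L), x \in B -> (k <= l1dist u (val x))%nat) ->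
    @marg_l1 d q U W (cube c L) (fun x => Some (eta x)) (fun x => Some (eta' x)) B
      <= b * exp (- (a * INR k)).

(* Main.v *)
(** The heat-bath operators [K_A] are orthogonal projections of [L^2(mu)], so
    with [E], [O] the even and odd sites the claim is [|K_O K_E f|^2 <= (1 - c) |f|^2]
    for mean-zero [f], equivalently
      [|f|^2 <= C (|f - K_E f|^2 + |f - K_O f|^2)].
    Cover the cube by finitely many families of pairwise separated cubes of bounded
    side, and let [B_k] be the union of the [k]-th family. Strong spatial mixing says
    that resampling a cube spreads the oscillation of [f] at a boundary site over the
    cube with exponentially decaying weights; since a site is a boundary site for only
    an [O(1/l)] fraction of the families, the average of the [K_{B_k}] contracts the
    total oscillation. A log-convexity argument turns this into
      [eps |f|^2 <= sum_k |f - K_{B_k} f|^2].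
    Inside one cube of bounded side, irreducibility of the single-site dynamics gives a
    Poincare inequality for [K_O K_E] with a uniform constant. It tensorizes over separated
    cubes, hence holds for each [B_k], and [|f - K_A f|] increases with [A]. *)
Require Import Defs.
From HB Require Import structures.
From mathcomp Require Import all_boot all_order all_algebra.
From mathcomp Require Import boolp reals Rstruct.
From mathcomp Require Import zify ring lra.

Set Implicit Arguments.
Unset Strict Implicit.
Unset Printing Implicit Defensive.

(** * Heat-bath projections *)

Section HeatBath.
Import Order.TTheory GRing.Theory Num.Theory.
Local Open Scope ring_scope.

Variables (R : realType) (I : finType) (q : nat).
Notation T := {ffun I -> 'I_q}.
Implicit Types (s t : T) (A B : {set I}) (f g h : T -> R).

(** Hard constraints shape the argument. Changing sites one at a time may pass through invalid
    configurations, so oscillations are measured over all configurations; this is possible because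
    permissiveness gives the Gibbs law of a small cube for every boundary condition. The kernels of
    small cubes are therefore defined everywhere, while the heat bath of the whole cube is
    meaningful only on its support, where the two agree. Mixing is assumed for cubes only, so a
    block that sticks out of the large cube cannot be cut down to a box: it is pushed inside.
    Contraction of the total oscillation carries a prefactor depending on [f] and on the cube.
    Self-adjointness of the averaged operator removes it and leaves the rate [1 - 1 / (2 * 6 ^ d)],
    whatever the size. The one free parameter is the block scale [l]: it is fixed by [d] and the
    mixing constants so that the loss at block boundaries is at most half of the gain from covering,
    and all local constants then depend on [l] and the spin system alone. *)

Definition agr A s t := [forall v, (v \notin A) ==> (s v == t v)].

Lemma agrP A s t : reflect (forall v, v \notin A -> s v = t v) (agr A s t).
Proof.
apply: (iffP forallP) => [H v vA|H v]; first by have /implyP/(_ vA)/eqP := H v.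
by apply/implyP => vA; rewrite H.
Qed.

Lemma agr_refl A s : agr A s s.
Proof. exact/agrP. Qed.

Lemma agr_sym A s t : agr A s t = agr A t s.
Proof. by apply/agrP/agrP => H v vA; rewrite H. Qed.

Lemma agr_trans A s t r : agr A s t -> agr A t r -> agr A s r.
Proof. by move=> /agrP H1 /agrP H2; apply/agrP => v vA; rewrite H1 ?H2. Qed.

Lemma agr_eqr A s s' : agr A s s' -> agr A s =1 agr A s'.
Proof.
move=> H t; apply/idP/idP; last exact: agr_trans.
by apply: agr_trans; rewrite agr_sym.
Qed.

Lemma agr_sub A B s t : A \subset B -> agr A s t -> agr B s t.
Proof.
move=> /subsetP sAB /agrP H; apply/agrP => v vB; apply: H.
by apply: contra vB; exact: sAB.
Qed.

Definition mix A s t : T := [ffun v => if v \in A then t v else s v].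

Lemma agr_mix A s t : agr A s (mix A s t).
Proof. by apply/agrP => v /negbTE vA; rewrite ffunE vA. Qed.

Variable w : T -> R.
Hypothesis w_ge0 : forall s, 0 <= w s.

(* Off the support of [w] the quotient may be [0 / 0 = 0]; identities between these
   operators therefore hold up to [eqw]. *)
Definition hb A f s : R :=
  (\sum_(t | agr A s t) w t * f t) / (\sum_(t | agr A s t) w t).

Definition ip f g : R := \sum_s w s * (f s * g s).
Definition nrm f : R := ip f f.
Definition eqw f g := forall s, w s != 0 -> f s = g s.

Lemma hbw_gt0 A s : w s != 0 -> 0 < \sum_(t | agr A s t) w t.
Proof.
move=> ws; rewrite (bigD1 s) ?agr_refl //= ltr_wpDr //; first exact: sumr_ge0.
by rewrite lt_def ws w_ge0.
Qed.

Lemma eqw_sym f g : eqw f g -> eqw g f.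
Proof. by move=> H s /H. Qed.

Lemma eqw_trans f g h : eqw f g -> eqw g h -> eqw f h.
Proof. by move=> H1 H2 s ws; rewrite H1 ?H2. Qed.

Lemma hb_eqw A f g : eqw f g -> hb A f = hb A g.
Proof.
move=> fg; apply: funext => s; rewrite /hb; congr (_ / _).
apply: eq_bigr => t _; have [->|wt] := eqVneq (w t) 0; first by rewrite !mul0r.
by rewrite fg.
Qed.

Lemma ip_eqw f f' g g' : eqw f f' -> eqw g g' -> ip f g = ip f' g'.
Proof.
move=> ff gg; apply: eq_bigr => s _.
have [->|ws] := eqVneq (w s) 0; first by rewrite !mul0r.
by rewrite ff ?gg.
Qed.

Lemma nrm_eqw f g : eqw f g -> nrm f = nrm g.
Proof. by move=> fg; exact: ip_eqw. Qed.

Lemma ipC f g : ip f g = ip g f.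
Proof. by apply: eq_bigr => s _; rewrite (mulrC (f s)). Qed.

Lemma ipDl f g h : ip (f \+ g) h = ip f h + ip g h.
Proof. by rewrite -big_split; apply: eq_bigr => s _ /=; ring. Qed.

Lemma ipBl f g h : ip (f \- g) h = ip f h - ip g h.
Proof. by rewrite -sumrB; apply: eq_bigr => s _ /=; ring. Qed.

Lemma ipZl c f g : ip (fun s => c * f s) g = c * ip f g.
Proof. by rewrite mulr_sumr; apply: eq_bigr => s _ /=; ring. Qed.

Lemma ipDr f g h : ip h (f \+ g) = ip h f + ip h g.
Proof. by rewrite ipC ipDl !(ipC h). Qed.

Lemma ipBr f g h : ip h (f \- g) = ip h f - ip h g.
Proof. by rewrite ipC ipBl !(ipC h). Qed.

Lemma ipZr c f g : ip f (fun s => c * g s) = c * ip f g.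
Proof. by rewrite ipC ipZl ipC. Qed.

Lemma nrmZ c g : nrm (fun s => c * g s) = c ^+ 2 * nrm g.
Proof. by rewrite /nrm ipZr ipZl mulrA. Qed.

Lemma nrm_ge0 f : 0 <= nrm f.
Proof. by apply: sumr_ge0 => s _; rewrite mulr_ge0 // -expr2 sqr_ge0. Qed.

Lemma nrmB f g : nrm (f \- g) = nrm f - 2 * ip f g + nrm g.
Proof. by rewrite /nrm ipBl !ipBr (ipC g f); ring. Qed.

Lemma nrmD_le f g : nrm (f \+ g) <= 2 * (nrm f + nrm g).
Proof.
have := nrm_ge0 (f \- g); rewrite nrmB /nrm ipDl !ipDr (ipC g f) => H.
by lra.
Qed.

Lemma nrmBC f g : nrm (f \- g) = nrm (g \- f).
Proof. by rewrite !nrmB ipC; ring. Qed.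

Lemma cauchy_schwarz f g : ip f g ^+ 2 <= nrm f * nrm g.
Proof.
have [g0|gn0] := eqVneq (nrm g) 0.
  have H x : 0 <= nrm f - 2 * x * ip f g.
    have := nrm_ge0 (f \- (fun s => x * g s)).
    by rewrite nrmB nrmZ ipZr g0 => H; lra.
  have [->|fg0] := eqVneq (ip f g) 0; first by rewrite expr0n /= g0 mulr0.
  (* For [nrm g = 0] the expansion is affine in [x], and this [x] makes it [-1]. *)
  have := H ((nrm f + 1) / (2 * ip f g)).
  have -> : 2 * ((nrm f + 1) / (2 * ip f g)) * ip f g = nrm f + 1 by field.
  by lra.
have g_gt0 : 0 < nrm g by rewrite lt_def gn0 nrm_ge0.
have := nrm_ge0 (f \- (fun s => ip f g / nrm g * g s)).
rewrite nrmB nrmZ ipZr =>  H; rewrite -subr_ge0.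
have -> : nrm f * nrm g - ip f g ^+ 2 = nrm g *
   (nrm f - 2 * (ip f g / nrm g * ip f g)
    
     + (ip f g / nrm g) ^+ 2 * nrm g) by field.
by rewrite mulr_ge0 // ltW.
Qed.

Lemma hb_class A f s t : agr A s t -> hb A f s = hb A f t.
Proof. by move=> st; rewrite /hb; congr (_ / _); apply: eq_bigl; exact: agr_eqr. Qed.

Lemma hb_const A f s c : w s != 0 ->
  (forall t, agr A s t -> w t != 0 -> f t = c) -> hb A f s = c.
Proof.
move=> ws H; rewrite /hb (eq_bigr (fun t => w t * c)) => [|t st].
  by rewrite -mulr_suml mulrAC divff ?mul1r // gt_eqF ?hbw_gt0.
have [->|wt] := eqVneq (w t) 0; first by rewrite !mul0r.
by rewrite H.
Qed.

(** Detailed balance: the kernel [w s * w t / Z] is symmetric because the normalisation [Z] is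
    shared by the whole class. *)
Lemma hb_adj A f g : ip g (hb A f) = ip (hb A g) f.
Proof.
have E f' g' : ip g' (hb A f') = \sum_s \sum_(t | agr A s t)
    w s * g' s * (w t * f' t) / (\sum_(r | agr A s r) w r).
  apply: eq_bigr => s _; rewrite /hb !mulrA -mulrA mulrA -mulr_suml mulr_sumr.
  by congr (_ * _); rewrite mulr_sumr.
rewrite E ipC E [RHS](exchange_big_dep xpredT) //=; apply: eq_bigr => s _.
rewrite (eq_bigl (fun t => agr A t s)) => [|t]; last by rewrite agr_sym.
apply: eq_bigr => t ts; rewrite [w t * _ * _]mulrC; congr (_ / _).
by apply: eq_bigl => r; rewrite (agr_eqr ts).
Qed.

Lemma hbB A f g : hb A (f \- g) = hb A f \- hb A g.
Proof.
apply: funext => s /=; rewrite /hb -mulrBl; congr (_ / _).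
by rewrite -sumrB; apply: eq_bigr => t _; rewrite mulrBr.
Qed.

Lemma hb_towerl A B f : A \subset B -> eqw (hb A (hb B f)) (hb B f).
Proof.
move=> sAB s ws; apply: hb_const => // t st _; apply: esym.
exact/hb_class/agr_sub/st.
Qed.

(** The indicator [g] of a class of [B] is constant on the classes of [A], so moving [hb A] onto it
    by self-adjointness leaves it unchanged. *)
Lemma hb_towerr A B f : A \subset B -> eqw (hb B (hb A f)) (hb B f).
Proof.
move=> sAB s ws; rewrite /hb; congr (_ / _).
pose g t : R := (agr B s t)%:R.
have E h : \sum_(t | agr B s t) w t * h t = ip g h.
  rewrite /ip big_mkcond; apply: eq_bigr => t _; rewrite /g.
  by case: ifP; rewrite ?mul1r ?mul0r ?mulr0.
rewrite !E hb_adj; apply: ip_eqw => // t wt; apply: hb_const => // r tr _.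
by rewrite /g agr_sym [in RHS]agr_sym -(agr_eqr (agr_sub sAB tr)).
Qed.

Lemma hb_idem A f : eqw (hb A (hb A f)) (hb A f).
Proof. exact: hb_towerl. Qed.

Lemma nrm_hb A f : nrm (hb A f) = ip f (hb A f).
Proof.
rewrite {1}/nrm -hb_adj; apply: ip_eqw => //; exact: hb_idem.
Qed.

Lemma nrm_subhb A f : nrm (f \- hb A f) = nrm f - nrm (hb A f).
Proof. by rewrite nrmB -nrm_hb; ring. Qed.

Lemma nrm_hb_le A f : nrm (hb A f) <= nrm f.
Proof. by rewrite -subr_ge0 -nrm_subhb nrm_ge0. Qed.

Lemma nrm_hb_anti A B f : A \subset B -> nrm (hb B f) <= nrm (hb A f).
Proof. by move=> sAB; rewrite -(nrm_eqw (hb_towerr f sAB)) nrm_hb_le. Qed.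

(** Best approximation by an orthogonal projection: the two sides differ by
    [nrm (hb A f \- hb A g)]. *)
Lemma hb_proj_le A f g : nrm (f \- hb A f) <= nrm (f \- hb A g).
Proof.
have E : ip f (hb A g) = ip (hb A f) (hb A g).
  by rewrite -hb_adj; apply: ip_eqw => //; apply: eqw_sym; exact: hb_idem.
rewrite nrm_subhb nrmB E -subr_ge0.
have := nrm_ge0 (hb A f \- hb A g); rewrite nrmB => H; lra.
Qed.

(** Conditional independence of [A] and [B] given the other sites, stated on the four corners of a
    rectangle so that no weight is divided by. *)
Definition exch A B := forall s t s' t',
  agr A s t -> agr A s' t' -> agr B s s' -> agr B t t' -> w s * w t' = w t * w s'.

Lemma exchC A B : exch A B -> exch B A.
Proof.
move=> E s t s' t' H1 H2 H3 H4; rewrite (E s s' t t') //.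
by rewrite mulrC.
Qed.

(** Under [exch] the conditional law on [A] does not see the values on [B]. *)
Lemma hb_inv A B g : exch A B -> [disjoint A & B] ->
  (forall s t, agr B s t -> w s != 0 -> w t != 0 -> g s = g t) ->
  forall s t, agr B s t -> w s != 0 -> w t != 0 -> hb A g s = hb A g t.
Proof.
move=> E dAB ginv s t st ws wt.
have mixK r x y : agr A x r -> agr B x y -> mix B (mix B r y) x = r.
  move=> /agrP xr /agrP xy; apply/ffunP => v; rewrite !ffunE.
  case vB: (v \in B) => //; apply: xr.
  by move: dAB; rewrite disjoint_sym => /disjointFr ->.
have mixA r x y : agr A x r -> agr B x y -> agr A y (mix B r y).
  move=> /agrP xr /agrP xy; apply/agrP => v vA; rewrite ffunE.
  case: ifP => // /negbT vB; by rewrite -xy // xr.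
(* Used with [h = g] for the numerator and [h = 1] for the denominator: overwriting [B] carries one
   class of [A] onto the other, and [exch] trades the weights. *)
have key h : (forall s t, agr B s t -> w s != 0 -> w t != 0 -> h s = h t) ->
    w s * \sum_(r | agr A t r) w r * h r = w t * \sum_(r | agr A s r) w r * h r.
  move=> hinv; rewrite (reindex_onto (fun r => mix B r t) (fun r => mix B r s)) /=; last first.
    by move=> r tr; apply: mixK => //; rewrite agr_sym.
  rewrite !mulr_sumr; apply: eq_big => r.
    apply/andP/idP => [[tr /eqP <-]|sr]; last by rewrite (mixA _ s) ?mixK.
    by apply: (mixA _ t) => //; rewrite agr_sym.
  move=> /andP[tr /eqP rE].
  have sr : agr A s r by rewrite -rE; apply: (mixA _ t) => //; rewrite agr_sym.
  have EE : w s * w (mix B r t) = w t * w r.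
    by rewrite (E s r t (mix B r t)) ?agr_mix // mulrC.
  rewrite !mulrA EE; have [w0|wn0] := eqVneq (w r) 0; first by rewrite w0 mulr0 !mul0r.
  congr (_ * _); apply: esym; apply: hinv => //; first exact: agr_mix.
  by apply/eqP => w0; move/eqP: EE; rewrite w0 mulr0 eq_sym mulf_eq0 (negbTE wt) (negbTE wn0).
have k1 := key g ginv.
have k2 : w s * \sum_(r | agr A t r) w r = w t * \sum_(r | agr A s r) w r.
  have M x : \sum_(r | agr A x r) w r = \sum_(r | agr A x r) w r * 1.
    by apply: eq_bigr => r _; rewrite mulr1.
  by rewrite !M; exact: key.
have bs : \sum_(r | agr A s r) w r != 0 by rewrite gt_eqF ?hbw_gt0.
have bt : \sum_(r | agr A t r) w r != 0 by rewrite gt_eqF ?hbw_gt0.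
rewrite /hb; apply/eqP; rewrite eqr_div //; apply/eqP.
set a := \sum_(r | agr A s r) w r * g r in k1 *; set b := \sum_(r | agr A s r) w r in k2 *.
set a' := \sum_(r | agr A t r) w r * g r in k1 *; set b' := \sum_(r | agr A t r) w r in k2 *.
apply: (@mulfI _ (w s * w t)); first by rewrite mulf_neq0.
transitivity ((w t * a) * (w s * b')); first by ring.
by rewrite k2 -k1; ring.
Qed.

(** The left side is constant on the valid part of each class of [A :|: B], hence fixed by
    [hb (A :|: B)], which absorbs both inner projections. *)
Lemma hb_setU A B f : exch A B -> [disjoint A & B] ->
  eqw (hb A (hb B f)) (hb (A :|: B) f).
Proof.
move=> E dAB.
have inv s t : agr (A :|: B) s t -> w s != 0 -> w t != 0 ->
    hb A (hb B f) s = hb A (hb B f) t.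
  move=> st ws wt; pose r := mix A s t; pose r' := mix B s t.
  have sr : agr A s r by exact: agr_mix.
  have sr' : agr B s r' by exact: agr_mix.
  have rt : agr B r t.
    apply/agrP => v vB; rewrite ffunE; case: ifP => // /negbT vA.
    by apply: (agrP _ _ _ st); rewrite inE negb_or vA.
  have r't : agr A r' t.
    apply/agrP => v vA; rewrite ffunE; case: ifP => // /negbT vB.
    by apply: (agrP _ _ _ st); rewrite inE negb_or vA.
  (* The intermediate corner is valid in spite of hard constraints, since
     [w s * w t = w r * w r']. *)
  have wr : w r != 0.
    apply/eqP => w0; have := E s r r' t sr r't sr' rt.
    by apply/eqP; rewrite w0 mul0r mulf_eq0 negb_or ws.
  rewrite (hb_class _ sr); apply: hb_inv rt wr wt => // x y xy _ _.
  exact: hb_class.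
apply: (@eqw_trans _ (hb (A :|: B) (hb A (hb B f)))).
  by move=> s ws; apply: esym; apply: hb_const => // t st wt; apply: esym; exact: inv.
apply: (eqw_trans (hb_towerr _ (subsetUl A B))); exact/hb_towerr/subsetUr.
Qed.

Lemma hb_comm A B f : exch A B -> [disjoint A & B] ->
  eqw (hb A (hb B f)) (hb B (hb A f)).
Proof.
move=> E dAB; apply: (eqw_trans (hb_setU f E dAB)); apply: eqw_sym.
rewrite setUC; apply: hb_setU; first exact: exchC.
by rewrite disjoint_sym.
Qed.

End HeatBath.

(** * Tensorization *)

Section Tensorization.
Import Order.TTheory GRing.Theory Num.Theory.
Local Open Scope ring_scope.

Variables (R : realType) (I : finType) (q : nat).
Notation T := {ffun I -> 'I_q}.
Implicit Types (A B : {set I}) (f : T -> R) (c : R).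
Variable w : T -> R.
Hypothesis w_ge0 : forall s, 0 <= w s.
Variable sep : rel I.
Hypothesis sep_irr : forall u, sep u u = false.

Definition sepset (A B : {set I}) := [forall u in A, forall v in B, sep u v].

Lemma sepsetP A B : reflect (forall u v, u \in A -> v \in B -> sep u v) (sepset A B).
Proof.
apply: (iffP 'forall_in_forall_inP) => [H u v uA|H u uA v]; first exact: H.
exact: H.
Qed.

Lemma sepsetS A B A' B' : A' \subset A -> B' \subset B -> sepset A B -> sepset A' B'.
Proof.
move=> /subsetP sA /subsetP sB /sepsetP H; apply/sepsetP => u v uA vB.
by apply: H; [exact: sA|exact: sB].
Qed.

Lemma sepset_disj A B : sepset A B -> [disjoint A & B].
Proof.
move=> /sepsetP H; apply/pred0P => u /=; apply/negP => /andP[uA uB].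
by have := H _ _ uA uB; rewrite sep_irr.
Qed.

Hypothesis exch_sep : forall A B, sepset A B -> exch w A B.

Lemma hb_sepU A B f : sepset A B -> eqw w (hb w A (hb w B f)) (hb w (A :|: B) f).
Proof. by move=> AB; apply: hb_setU => //; [exact: exch_sep|exact: sepset_disj]. Qed.

Lemma hb_sepC A B f : sepset A B -> eqw w (hb w A (hb w B f)) (hb w B (hb w A f)).
Proof. by move=> AB; apply: hb_comm => //; [exact: exch_sep|exact: sepset_disj]. Qed.

Variable E : {set I}.

Definition scan A (f : T -> R) := hb w (A :\: E) (hb w (A :&: E) f).

(** Equivalently, [nrm (scan A f) - nrm (hb A f) <= (1 - c) * (nrm f - nrm (hb A f))], a contraction
    conditional on the sites outside [A]. In this form [c] survives unions of separated sets. *)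
Definition scan_contr c A := forall f : T -> R,
  nrm w (scan A f) <= (1 - c) * nrm w f + c * nrm w (hb w A f).

(** With [g = hb (A :&: E) f], the squares of [f - g] and [g - scan A f] sum to
    [nrm f - nrm (scan A f)]. The first bounds one defect; best approximation and the detour through
    [g] bound the other by twice the sum. *)
Lemma scan_energy A (f : T -> R) :
  nrm w (f \- hb w (A :&: E) f) + nrm w (f \- hb w (A :\: E) f)
    <= 3 * (nrm w f - nrm w (scan A f)).
Proof.
have H1 := hb_proj_le w_ge0 (A :\: E) f (hb w (A :&: E) f).
have := nrmD_le w_ge0 (f \- hb w (A :&: E) f)
  (hb w (A :&: E) f \- hb w (A :\: E) (hb w (A :&: E) f)).
rewrite (@nrm_eqw _ _ _ w _ (f \- hb w (A :\: E) (hb w (A :&: E) f))); last first.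
  by move=> s _ /=; ring.
move: H1; rewrite !nrm_subhb // -/(scan A f) => H1 H2.
have := nrm_hb_le w_ge0 (A :\: E) (hb w (A :&: E) f); rewrite -/(scan A f) => H3.
lra.
Qed.

(** The converse comparison: the defect of [g] under [B] is split along [g = f + (g - f)]. *)
Lemma scan_energy_ge A (f : T -> R) : nrm w f - nrm w (scan A f)
  <= 3 * (nrm w (f \- hb w (A :&: E) f) + nrm w (f \- hb w (A :\: E) f)).
Proof.
set B := A :\: E; set g := hb w (A :&: E) f.
have H := nrmD_le w_ge0 (f \- hb w B f) ((g \- f) \- hb w B (g \- f)).
have H' : nrm w (g \- hb w B g) <=
    2 * (nrm w (f \- hb w B f) + nrm w ((g \- f) \- hb w B (g \- f))).
  rewrite (_ : nrm w (g \- hb w B g) = nrm w ((f \- hb w B f) \+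
     ((g \- f) \- hb w B (g \- f)))) //.
  by apply: nrm_eqw => s _ /=; rewrite hbB /=; ring.
move: H'; rewrite (nrm_subhb w_ge0 B (g \- f)) (nrmBC w g f).
rewrite (nrm_subhb w_ge0 B g) (nrm_subhb w_ge0 B f).
have := nrm_ge0 w_ge0 (hb w B (g \- f)); have := nrm_subhb w_ge0 (A :&: E) f.
have := nrm_hb_le w_ge0 B f; rewrite -/g /scan -/B -/g.
lra.
Qed.

Lemma scan_contr_of_energy C A : 0 < C ->
  (forall f : T -> R, nrm w (f \- hb w A f) <=
     C * (nrm w (f \- hb w (A :&: E) f) + nrm w (f \- hb w (A :\: E) f))) ->
  scan_contr (3 * C)^-1 A.
Proof.
move=> C0 H f; have H1 := scan_energy A f; have := H f.
rewrite (nrm_subhb w_ge0 A f) => H2.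
have H3 : nrm w f - nrm w (hb w A f) <= 3 * C * (nrm w f - nrm w (scan A f)).
  by apply: (le_trans H2); rewrite [3 * C]mulrC -mulrA ler_pM2l.
move: H3; rewrite -ler_pdivrMl ?mulr_gt0 // => H3; lra.
Qed.

Lemma energy_of_scan_contr c A (f : T -> R) : scan_contr c A ->
  c * nrm w (f \- hb w A f) <=
    3 * (nrm w (f \- hb w (A :&: E) f) + nrm w (f \- hb w (A :\: E) f)).
Proof.
move=> /(_ f) H; have := scan_energy_ge A f; rewrite (nrm_subhb w_ge0 A f); lra.
Qed.

Lemma scan_sepC A B f : sepset A B -> eqw w (hb w A (scan B f)) (scan B (hb w A f)).
Proof.
move=> AB; rewrite /scan.
have S1 : sepset A (B :\: E) by apply: sepsetS AB => //; exact: subsetDl.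
have S2 : sepset A (B :&: E) by apply: sepsetS AB => //; exact: subsetIl.
apply: (eqw_trans (hb_sepC _ S1)).
by rewrite (hb_eqw _ (hb_sepC f S2)).
Qed.

Lemma scan_sepU A B f : sepset A B -> eqw w (scan (A :|: B) f) (scan A (scan B f)).
Proof.
move=> AB; rewrite /scan setDUl setIUl.
have S A' B' : A' \subset A -> B' \subset B -> sepset A' B'.
  by move=> sA sB; apply: sepsetS AB.
have S1 := S _ _ (subsetDl A E) (subsetDl B E).
have S2 := S _ _ (subsetIl A E) (subsetIl B E).
have S3 := S _ _ (subsetIl A E) (subsetDl B E).
apply: (@eqw_trans _ _ _ _ _ (hb w (A :\: E) (hb w (B :\: E)
   (hb w (A :&: E :|: B :&: E) f)))).
  by apply: eqw_sym; exact: hb_sepU.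
rewrite -(hb_eqw _ (hb_sepU f S2)).
by rewrite (hb_eqw _ (hb_sepC _ S3)).
Qed.

(* With x = |f|^2, y = |K_B f|^2, z = |K_A f|^2 and t = |K_A K_B f|^2, the bound
   reduces to x - y - z + t = |(1 - K_A)(1 - K_B) f|^2 >= 0. *)
Lemma scan_contrU c A B : 0 <= c <= 1 -> sepset A B ->
  scan_contr c A -> scan_contr c B -> scan_contr c (A :|: B).
Proof.
move=> /andP[c0 c1] AB cA cB f.
rewrite (nrm_eqw (scan_sepU f AB)).
have H1 := cA (scan B f); have H2 := cB f; have H3 := cB (hb w A f).
rewrite (nrm_eqw (scan_sepC f AB)) in H1.
have K : nrm w (hb w B (hb w A f)) = nrm w (hb w (A :|: B) f).
  by rewrite -(nrm_eqw (hb_sepU f AB)) (nrm_eqw (hb_sepC f AB)).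
rewrite K in H3.
have P := nrm_ge0 w_ge0 ((f \- hb w B f) \- hb w A (f \- hb w B f)).
rewrite (nrm_subhb w_ge0) (nrm_subhb w_ge0) hbB in P.
have Q : nrm w (hb w A f \- hb w A (hb w B f)) =
    nrm w (hb w A f) - nrm w (hb w (A :|: B) f).
  rewrite -K -(nrm_subhb w_ge0 B (hb w A f)); apply: nrm_eqw => s ws /=.
  by rewrite (hb_sepC f AB).
rewrite Q in P.
have X1 : (1 - c) * nrm w (scan B f) <=
   (1 - c) * ((1 - c) * nrm w f + c * nrm w (hb w B f)).
  by rewrite ler_wpM2l // subr_ge0.
have X2 := ler_wpM2l c0 H3.
apply: (le_trans H1); apply: (le_trans (lerD X1 X2)).
have Y : 0 <= c * (1 - c) * (nrm w f - nrm w (hb w B f) -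
  (nrm w (hb w A f) - nrm w (hb w (A :|: B) f))).
  by rewrite mulr_ge0 // mulr_ge0 // subr_ge0.
by rewrite -subr_ge0; move: Y; congr (0 <= _); ring.
Qed.

Lemma scan_contr0 c : 0 <= c <= 1 -> scan_contr c set0.
Proof.
move=> /andP[c0 c1] f; rewrite /scan set0D set0I.
have H := nrm_hb_le w_ge0 set0 f; rewrite (nrm_eqw (hb_idem w_ge0 _ _)).
have : (1 - c) * nrm w (hb w set0 f) <= (1 - c) * nrm w f.
  by rewrite ler_wpM2l // subr_ge0.
lra.
Qed.

Lemma in_bigcup_seq (J : Type) (r : seq J) (A : J -> {set I}) v :
  (v \in \bigcup_(j <- r) A j) = has (fun j => v \in A j) r.
Proof. by elim: r => [|j r IH]; rewrite ?big_nil ?big_cons !inE //= IH. Qed.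

Lemma scan_contr_bigU (J : eqType) (r : seq J) (A : J -> {set I}) c :
  0 <= c <= 1 -> uniq r -> {in r &, forall i j, i != j -> sepset (A i) (A j)} ->
  {in r, forall j, scan_contr c (A j)} -> scan_contr c (\bigcup_(j <- r) A j).
Proof.
move=> c01; elim: r => [|j r IH] /=; first by rewrite big_nil => *; exact: scan_contr0.
move=> /andP[jr ur] sepr cr; rewrite big_cons; apply: scan_contrU => //.
- apply/sepsetP => u v uj; rewrite in_bigcup_seq => /hasP[i ir vi].
  have /sepsetP : sepset (A j) (A i); last exact.
  apply: sepr; rewrite ?mem_head // ?inE ?ir ?orbT //.
  by apply: contraNneq jr => ->.
- by apply: cr; rewrite mem_head.
- apply: IH => //; last by move=> i ir; apply: cr; rewrite inE ir orbT.
  by move=> i k ir kr; apply: sepr; rewrite inE ?ir ?kr orbT.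
Qed.

End Tensorization.

(** * From contraction of oscillations to variance *)

Section Contraction.
Import Order.TTheory GRing.Theory Num.Theory.
Local Open Scope ring_scope.

Lemma geometric_unbounded (R : realType) (x C : R) : 1 < x -> exists n, C < x ^+ n.
Proof.
move=> x1; have x0 : 0 < x - 1 by rewrite subr_gt0.
have B n : 1 + n%:R * (x - 1) <= x ^+ n.
  elim: n => [|n IH]; first by rewrite mul0r addr0 expr0.
  have H : (1 + n%:R * (x - 1)) * x <= x ^+ n * x by rewrite ler_wpM2r // ltW // (lt_trans ltr01).
  rewrite exprSr; apply: le_trans H; rewrite -subr_ge0 -natr1.
  have -> : (1 + n%:R * (x - 1)) * x - (1 + (n%:R + 1) * (x - 1)) =
     n%:R * (x - 1) ^+ 2 by ring.
  by rewrite mulr_ge0 // sqr_ge0.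
have /archi_boundP : 0 <= `|C| / (x - 1) by rewrite divr_ge0 // ltW.
set n := Num.bound _ => H; exists n.
apply: lt_le_trans (B n); rewrite ltr_pdivrMr // in H.
by apply: (le_lt_trans (ler_norm C)); lra.
Qed.

Variables (R : realType) (I : finType) (q : nat).
Notation T := {ffun I -> 'I_q}.
Implicit Types (f g : T -> R) (rho : R).
Variable w : T -> R.
Hypothesis w_ge0 : forall s, 0 <= w s.

Local Notation one := (fun _ : T => 1 : R).

(** For mean-zero [f], the value [f s] is the weighted average of [f s - f t] over [t]. *)
Lemma nrm_osc f c : ip w one f = 0 ->
  (forall s t, w s != 0 -> w t != 0 -> `|f s - f t| <= c) ->
  nrm w f <= c ^+ 2 * \sum_s w s.
Proof.
move=> f0 fc; pose W := \sum_s w s.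
have [W0|Wn0] := eqVneq W 0.
  rewrite -/W W0 mulr0 /nrm /ip big1 // => s _.
  have -> : w s = 0; last by rewrite mul0r.
  by apply: (psumr_eq0P _ W0).
have Wgt0 : 0 < W by rewrite lt_def Wn0 sumr_ge0.
have fs s : w s != 0 -> `|f s| <= c.
  move=> ws.
  have -> : f s = (\sum_t w t * (f s - f t)) / W.
    have -> : \sum_t w t * (f s - f t) = f s * W - ip w one f.
      by rewrite mulr_sumr -sumrB; apply: eq_bigr => t _; ring.
    by rewrite f0 subr0 mulfK.
  rewrite normrM normfV (gtr0_norm Wgt0) ler_pdivrMr //.
  apply: (le_trans (ler_norm_sum _ _ _)); rewrite mulr_sumr; apply: ler_sum => t _.
  rewrite normrM (ger0_norm (w_ge0 t)) mulrC.
  have [->|wt] := eqVneq (w t) 0; first by rewrite !mulr0.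
  by rewrite ler_wpM2r // fc.
rewrite /nrm /ip mulr_sumr; apply: ler_sum => s _; rewrite mulrC.
have [->|/fs fsc] := eqVneq (w s) 0; first by rewrite !mulr0.
rewrite ler_wpM2r // -expr2 -real_normK ?num_real // lerXn2r ?nnegrE //.
exact: le_trans fsc.
Qed.

(* |P^n f|^2 is log-convex in n, so its geometric decay rate is attained from the
   first step on. *)
Lemma selfadjoint_contr (P : (T -> R) -> T -> R) rho f :
  (forall g h, ip w g (P h) = ip w (P g) h) ->
  (forall g, ip w one g = 0 -> ip w one (P g) = 0) ->
  0 < rho -> ip w one f = 0 ->
  (exists c, forall n s t, w s != 0 -> w t != 0 ->
      `|iter n P f s - iter n P f t| <= c * rho ^+ n) ->
  nrm w (P f) <= rho ^+ 2 * nrm w f.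
Proof.
move=> Padj P1 rho0 f0 [c fc]; pose a n := nrm w (iter n P f).
have a_ge0 n : 0 <= a n by exact: nrm_ge0.
have mean n : ip w one (iter n P f) = 0 by elim: n => [|n IH] //=; exact: P1.
have acvx n : a n.+1 ^+ 2 <= a n * a n.+2.
  have -> : a n.+1 = ip w (iter n P f) (iter n.+2 P f) by rewrite [RHS]Padj.
  exact: cauchy_schwarz.
have abd n : a n <= (c * rho ^+ n) ^+ 2 * \sum_s w s.
  by apply: nrm_osc => // s t ws wt; exact: fc.
rewrite -[X in X <= _]/(a 1%N) -[nrm w f]/(a 0%N).
case: (leP (a 1%N) (rho ^+ 2 * a 0%N)) => // a1.
have a1gt0 : 0 < a 1%N by apply: le_lt_trans a1; rewrite mulr_ge0 // sqr_ge0.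
have a0gt0 : 0 < a 0%N.
  rewrite lt_def a_ge0 andbT; apply/eqP => a00.
  by have := acvx 0%N; rewrite a00 mul0r leNgt exprn_gt0.
pose x := a 1%N / a 0%N.
have x0 : 0 < x by rewrite divr_gt0.
(* The ratios [a n.+1 / a n] are nondecreasing, so none falls below the first one, [x]; as
   [x > rho ^+ 2], this outgrows [abd]. *)
have grow n : 0 < a n /\ x * a n <= a n.+1.
  elim: n => [|n [an IH]]; first by rewrite /x divfK // gt_eqF.
  have an1 : 0 < a n.+1 by apply: lt_le_trans IH; rewrite mulr_gt0.
  split=> //; rewrite -(ler_pM2l an); apply: le_trans (acvx n).
  by rewrite expr2 mulrA ler_pM2r // mulrC.
have lb n : x ^+ n * a 0%N <= a n.
  elim: n => [|n IH]; first by rewrite mul1r.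
  apply: le_trans (proj2 (grow n)); rewrite exprS -mulrA ler_pM2l //.
have r1 : 1 < x / rho ^+ 2.
  by rewrite ltr_pdivlMr ?exprn_gt0 // mul1r /x ltr_pdivlMr.
have [n] := geometric_unbounded (c ^+ 2 * (\sum_s w s) / a 0%N) r1.
rewrite ltr_pdivrMr // expr_div_n [X in _ < X]mulrAC ltr_pdivlMr ?exprn_gt0 // ltNge => /negP[].
apply: (le_trans (lb n)); apply: (le_trans (abd n)).
by rewrite exprMn -!exprM (mulnC 2%N) mulrAC.
Qed.

Variables (K : finType) (A : K -> {set I}).
Definition avg_hb f s : R := (\sum_k hb w (A k) f s) / #|K|%:R.

(** The right side is [#|K|] times the Dirichlet form [nrm f - ip f (avg_hb f)], which
    Cauchy-Schwarz bounds below by [(1 - rho) * nrm f]; the factor [#|K| >= 1] is given away. *)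
Lemma avg_hb_variance rho f : (0 < #|K|)%N -> 0 < rho < 1 -> ip w one f = 0 ->
  (exists c, forall n s t, w s != 0 -> w t != 0 ->
      `|iter n avg_hb f s - iter n avg_hb f t| <= c * rho ^+ n) ->
  (1 - rho) * nrm w f <= \sum_k nrm w (f \- hb w (A k) f).
Proof.
move=> K0 /andP[rho0 rho1] f0 fc.
have Kgt0 : 0 < #|K|%:R :> R by rewrite ltr0n.
have ipP g h : ip w g (avg_hb h) = (\sum_k ip w g (hb w (A k) h)) / #|K|%:R.
  rewrite /ip exchange_big mulr_suml; apply: eq_bigr => s _ /=.
  by rewrite /avg_hb -mulr_sumr -mulr_sumr -!mulrA.
have Padj g h : ip w g (avg_hb h) = ip w (avg_hb g) h.
  rewrite ipP ipC ipP; congr (_ / _); apply: eq_bigr => k _.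
  by rewrite hb_adj ipC.
have P1 g : ip w one g = 0 -> ip w one (avg_hb g) = 0.
  move=> g0; rewrite ipP big1 ?mul0r // => k _; rewrite hb_adj -g0.
  by apply: ip_eqw => // s ws; apply: hb_const.
have H := selfadjoint_contr Padj P1 rho0 f0 fc.
have cs := cauchy_schwarz w_ge0 f (avg_hb f).
have ipf : ip w f (avg_hb f) <= rho * nrm w f.
  have n0 := nrm_ge0 w_ge0 f.
  have : ip w f (avg_hb f) ^+ 2 <= (rho * nrm w f) ^+ 2.
    apply: (le_trans cs); rewrite exprMn expr2 [nrm w f ^+ 2]expr2 mulrA [X in _ <= X]mulrC.
    by rewrite ler_wpM2l.
  have [|neg] := leP 0 (ip w f (avg_hb f)).
    by move=> p0; rewrite ler_pXn2r ?nnegrE // mulr_ge0 // ltW.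
  by move=> _; apply: (le_trans (ltW neg)); rewrite mulr_ge0 // ltW.
have E : \sum_k nrm w (f \- hb w (A k) f) = #|K|%:R * (nrm w f - ip w f (avg_hb f)).
  rewrite ipP mulrBr mulrCA divff ?mulr1 ?gt_eqF //.
  rewrite (eq_bigr (fun k => nrm w f - ip w f (hb w (A k) f))) => [|k _].
    by rewrite sumrB sumr_const mulr_natl.
  by rewrite nrm_subhb // nrm_hb.
rewrite E; apply: (@le_trans _ _ (1 * (nrm w f - ip w f (avg_hb f)))); first by lra.
rewrite ler_wpM2r ?ler1n // subr_ge0; apply: (le_trans ipf).
by rewrite ler_piMl ?nrm_ge0 // ltW.
Qed.

End Contraction.

(** * Lipschitz vectors and block dynamics *)

Section Lipschitz.
Import Order.TTheory GRing.Theory Num.Theory.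
Local Open Scope ring_scope.

Variables (R : realType) (I : finType) (q : nat).
Notation T := {ffun I -> 'I_q}.
Implicit Types (f g h : T -> R) (D : I -> R) (s t : T).

(** Configurations of weight zero are included, so that any two configurations can be joined by
    changing sites one at a time. *)
Definition lip f D := forall v s t, agr [set v] s t -> `|f s - f t| <= D v.

Lemma lip_ge0 f D v s : lip f D -> 0 <= D v.
Proof. by move=> /(_ v s s (agr_refl _ _)); apply: le_trans. Qed.

Lemma lip_le f D D' : lip f D -> (forall v, D v <= D' v) -> lip f D'.
Proof. by move=> fD DD v s t st; apply: le_trans (DD v); exact: fD. Qed.

Lemma lip_seq f D (l : seq I) s t : lip f D -> uniq l ->
  agr [set v in l] s t -> `|f s - f t| <= \sum_(v <- l) D v.
Proof.
move=> fD; elim: l s => [|v l IH] s /=.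
  move=> _ /agrP st; rewrite big_nil (_ : s = t) ?subrr ?normr0 //.
  by apply/ffunP => v; apply: st; rewrite inE.
move=> /andP[vl ul] /agrP st; rewrite big_cons -(subrKA (f (mix [set v] s t))).
apply: (le_trans (ler_normD _ _)); apply: lerD; first exact/fD/agr_mix.
apply: IH => //; apply/agrP => u; rewrite !inE ffunE inE => ul'.
by case: eqP => [//|/eqP uv]; apply: st; rewrite !inE negb_or uv.
Qed.

Lemma lip_total f D s t : lip f D -> `|f s - f t| <= \sum_v D v.
Proof.
move=> fD; rewrite -big_enum; apply: lip_seq => //=; first exact: enum_uniq.
by apply/agrP => v; rewrite inE mem_enum.
Qed.

Definition mar (mu : T -> R) (B : {set I}) (r : {ffun {x : I | x \in B} -> 'I_q}) : R :=
  \sum_(s : T | [forall x, s (val x) == r x]) mu s.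

(** Since [agr (~: B)] is agreement on [B], the test function [h] is constant on the fibres of the
    restriction to [B]. *)
Lemma mar_test (mu nu : T -> R) (B : {set I}) h c :
  (forall s t, agr (~: B) s t -> h s = h t) -> (forall s, `|h s| <= c) ->
  `|\sum_s (mu s - nu s) * h s| <= c * \sum_r `|mar mu (B := B) r - mar nu r|.
Proof.
move=> hB hc; pose res (s : T) : {ffun {x : I | x \in B} -> 'I_q} := [ffun x => s (val x)].
rewrite (partition_big res xpredT) //=; apply: (le_trans (ler_norm_sum _ _ _)).
rewrite mulr_sumr; apply: ler_sum => r _.
have E s : (res s == r) = [forall x, s (val x) == r x].
  apply/eqP/forallP => [<- x|H]; first by rewrite ffunE.
  by apply/ffunP => x; rewrite ffunE; exact/eqP.
rewrite /mar -sumrB; rewrite (eq_bigl _ _ E).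
case: (pickP (fun s => [forall x, s (val x) == r x])) => [s0 s0r|no]; last first.
  by rewrite !big_pred0 // normr0 mulr0.
have -> : \sum_(s : T | [forall x, s (val x) == r x]) (mu s - nu s) * h s =
   \sum_(s : T | [forall x, s (val x) == r x]) (mu s - nu s) * h s0.
  apply: eq_bigr => s /forallP sr; congr (_ * _); apply: hB; apply/agrP => v.
  rewrite inE negbK => vB; have := sr (exist _ v vB); move/forallP: s0r => /(_ (exist _ v vB)).
  by move=> /eqP /= -> /eqP ->.
by rewrite -mulr_suml normrM mulrC ler_wpM2r.
Qed.

(* Freezing the sites one at a time, nearest first, each increment only involves
   sites at distance at least that of the frozen one. *)
Lemma marginals_lip (mu nu : T -> R) (dist : I -> nat) (beta : nat -> R) (t0 : T) g D :
  \sum_s mu s = \sum_s nu s ->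
  (forall k, \sum_r `|mar mu (B := [set v | (k <= dist v)%N]) r - mar nu r| <= beta k) ->
  lip g D ->
  `|\sum_s mu s * g s - \sum_s nu s * g s| <= \sum_v beta (dist v) * D v.
Proof.
move=> tot mb gD.
have -> : \sum_s mu s * g s - \sum_s nu s * g s = \sum_s (mu s - nu s) * g s.
  by rewrite -sumrB; apply: eq_bigr => s _; ring.
pose l := sort (fun u v => (dist u <= dist v)%N) (enum I).
have lP : perm_eq l (index_enum I).
  apply: uniq_perm; rewrite ?sort_uniq ?enum_uniq ?index_enum_uniq // => v.
  by rewrite mem_sort mem_enum mem_index_enum.
have ls : sorted (fun u v => (dist u <= dist v)%N) l.
  by apply: sort_sorted => u v; exact: leq_total.
(* The invariant of the induction below: [g] depends only on the sites still in the list. *)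
have gl s t : {in l, s =1 t} -> g s = g t.
  by move=> st; congr g; apply/ffunP => v; apply: st; rewrite (perm_mem lP) mem_index_enum.
rewrite -(perm_big _ lP) /=; move: l ls gl {lP} => l.
elim: l g gD => [|v l IH] g gD ls gl.
  rewrite big_nil (eq_bigr (fun s => (mu s - nu s) * g t0)) => [|s _].
    by rewrite -mulr_suml sumrB tot subrr mul0r normr0.
  by congr (_ * _); exact: gl.
have lsv : sorted (fun u v => (dist u <= dist v)%N) l by exact: path_sorted ls.
have lv u : u \in l -> (dist v <= dist u)%N.
  move: ls; rewrite /= path_sortedE; last by move=> x y z; exact: leq_trans.
  by move=> /andP[/allP H _]; exact: H.
pose g' s := g (mix [set v] s t0).
have -> : \sum_s (mu s - nu s) * g s =
    \sum_s (mu s - nu s) * (g s - g' s) + \sum_s (mu s - nu s) * g' s.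
  by rewrite -big_split; apply: eq_bigr => s _ /=; ring.
rewrite big_cons; apply: (le_trans (ler_normD _ _)); apply: lerD.
- apply: (le_trans (@mar_test mu nu [set u | (dist v <= dist u)%N] _ (D v) _ _)).
  + move=> s t /agrP st; have st' u : u \in v :: l -> s u = t u.
      by rewrite inE => ul; apply: st; rewrite !inE negbK; case/orP: ul => [/eqP->|/lv].
    rewrite (gl _ _ (fun u ul => st' u ul)) /g' (gl (mix [set v] s t0) (mix [set v] t t0)) // => u ul.
    by rewrite !ffunE st'.
  + by move=> s; apply/gD/agr_mix.
  + by rewrite mulrC ler_wpM2r // (lip_ge0 _ t0 gD).
- apply: IH => //.
  + move=> u s t /agrP st; apply: gD; apply/agrP => x xu.
    by rewrite !ffunE; case: ifP => // _; exact: st.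
  + move=> s t st; apply: gl => u; rewrite !ffunE !inE.
    by case: eqP => //= _; exact: st.
Qed.

Variables (J : eqType) (N : J -> (T -> R) -> T -> R) (Lam bd : J -> {set I}).
Variable infl : I -> I -> R.
Hypothesis infl_ge0 : forall u v, 0 <= infl u v.
Hypothesis lipN : forall j f D, lip f D ->
  lip (N j f) (fun u => (u \notin Lam j)%:R * D u +
                        (u \in bd j)%:R * \sum_(v in Lam j) infl u v * D v).

Definition compN (r : seq J) f := foldr N f r.

(** Blocks of one family meet neither each other nor each other's boundaries, so inside a block the
    oscillations are untouched by the other updates: the bounds add up instead of compounding. *)
Lemma lip_compN r f D : (0 < #|T|)%N -> uniq r ->
  {in r &, forall i j, i != j -> [disjoint Lam i & Lam j] && [disjoint Lam i & bd j]} ->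
  lip f D ->
  lip (compN r f) (fun u => (u \notin \bigcup_(j <- r) Lam j)%:R * D u +
    (u \in \bigcup_(j <- r) bd j)%:R * \sum_(v in \bigcup_(j <- r) Lam j) infl u v * D v).
Proof.
move=> /card_gt0P[t0 _] + + fD; have D0 v : 0 <= D v by exact: lip_ge0 fD.
elim: r => [|j r IH].
  move=> _ _; apply: (lip_le fD) => v.
  by rewrite !big_nil !inE mul1r mul0r addr0.
move=> /= /andP[jr ur] sep.
have sepr i : i \in r -> [disjoint Lam j & Lam i] && [disjoint Lam j & bd i].
  move=> ir; apply: sep; rewrite ?mem_head // ?inE ?ir ?orbT //.
  by apply: contraNneq jr => ->.
have {}IH : lip (compN r f) _ := IH ur (fun x y xr yr => sep x y
   (mem_behead (s := j :: r) xr) (mem_behead (s := j :: r) yr)).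
apply: (lip_le (lipN j IH)) => u; rewrite !big_cons.
set LL := \bigcup_(j <- r) Lam j; set BB := \bigcup_(j <- r) bd j.
have dis : [disjoint Lam j & LL].
  apply/pred0P => v /=; apply/negP => /andP[vj]; rewrite in_bigcup_seq => /hasP[i ir vi].
  by have /andP[/disjointFr/(_ vj)] := sepr i ir; rewrite vi.
have disb v : v \in Lam j -> v \notin BB.
  move=> vj; rewrite in_bigcup_seq; apply/hasPn => i ir.
  by have /andP[_ /disjointFr/(_ vj) ->] := sepr i ir.
have Dj v : v \in Lam j -> (v \notin LL)%:R * D v +
   (v \in BB)%:R * \sum_(v0 in LL) infl v v0 * D v0 = D v.
  by move=> vj; rewrite (disjointFr dis vj) (negbTE (disb v vj)) mul1r mul0r addr0.
have -> : \sum_(v in Lam j) infl u v * ((v \notin LL)%:R * D v +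
    (v \in BB)%:R * \sum_(v0 in LL) infl v v0 * D v0) = \sum_(v in Lam j) infl u v * D v.
  by apply: eq_bigr => v vj; rewrite Dj.
have -> : \sum_(v in Lam j :|: LL) infl u v * D v =
    \sum_(v in Lam j) infl u v * D v + \sum_(v in LL) infl u v * D v.
  by rewrite -bigU //; apply: eq_bigl => v; rewrite in_setU.
rewrite !in_setU negb_or.
have S1 : 0 <= \sum_(v in Lam j) infl u v * D v by apply: sumr_ge0 => v _; rewrite mulr_ge0.
have S2 : 0 <= \sum_(v in LL) infl u v * D v by apply: sumr_ge0 => v _; rewrite mulr_ge0.
have := D0 u; move: S1 S2.
move: (\sum_(v in Lam j) _) (\sum_(v in LL) _) (D u) => x y z x0 y0 z0.
by case: (u \in Lam j); case: (u \in LL); case: (u \in bd j); case: (u \in BB) => /=; lra.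
Qed.

Variables (K : finType) (blocks : K -> seq J).
Definition avgN f s := (\sum_k compN (blocks k) f s) / #|K|%:R.

(** At each [u], at least [m1] families erase [D u] and at most [m2] let [u] inherit oscillation
    from inside a block. Summed over [u], what is inherited from one site [v] carries a factor at
    most [G]. *)
Lemma avgN_contr (m1 m2 : nat) (G : R) f D : (0 < #|T|)%N -> (0 < #|K|)%N ->
  (forall k, uniq (blocks k)) ->
  (forall k, {in blocks k &, forall i j, i != j ->
     [disjoint Lam i & Lam j] && [disjoint Lam i & bd j]}) ->
  (forall u, (m1 <= #|[set k | u \in \bigcup_(j <- blocks k) Lam j]|)%N) ->
  (forall u, (#|[set k | u \in \bigcup_(j <- blocks k) bd j]| <= m2)%N) ->
  (forall v, \sum_u infl u v <= G) ->
  lip f D -> exists2 D', lip (avgN f) D' &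
    \sum_u D' u <= (1 - (m1%:R - m2%:R * G) / #|K|%:R) * \sum_u D u.
Proof.
move=> T0 K0 ub sepb cov bdy sumG fD.
have Kgt0 : 0 < #|K|%:R :> R by rewrite ltr0n.
have D0 v : 0 <= D v by case/card_gt0P: T0 => t0 _; exact: lip_ge0 fD.
pose S u := \sum_v infl u v * D v.
have S0 u : 0 <= S u by apply: sumr_ge0 => v _; rewrite mulr_ge0.
exists (fun u => (#|K|%:R - m1%:R) / #|K|%:R * D u + m2%:R / #|K|%:R * S u).
  move=> u s t st; rewrite /avgN -mulrBl normrM normfV (gtr0_norm Kgt0).
  rewrite ler_pdivrMr // -sumrB; apply: (le_trans (ler_norm_sum _ _ _)).
  apply: (@le_trans _ _ (\sum_k ((u \notin \bigcup_(j <- blocks k) Lam j)%:R * D u +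
      (u \in \bigcup_(j <- blocks k) bd j)%:R * S u))).
    apply: ler_sum => k _; apply: (le_trans (lip_compN T0 (ub k) (sepb k) fD st)).
    rewrite lerD2l ler_wpM2l // /S [X in _ <= X](bigID (mem (\bigcup_(j <- blocks k) Lam j))) /=.
    by rewrite lerDl sumr_ge0 // => v _; rewrite mulr_ge0.
  have -> : ((#|K|%:R - m1%:R) / #|K|%:R * D u + m2%:R / #|K|%:R * S u) * #|K|%:R =
     (#|K|%:R - m1%:R) * D u + m2%:R * S u by field; rewrite gt_eqF.
  rewrite big_split -!mulr_suml /=; apply: lerD; apply: ler_wpM2r => //.
    have -> : \sum_k (u \notin \bigcup_(j <- blocks k) Lam j)%:R =
       #|K|%:R - #|[set k | u \in \bigcup_(j <- blocks k) Lam j]|%:R :> R.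
      rewrite -(cardC (mem [set k | u \in \bigcup_(j <- blocks k) Lam j])) natrD addrC addKr.
      rewrite -sum1_card natr_sum [RHS]big_mkcond; apply: eq_bigr => k _.
      by rewrite !inE; case: (u \in _).
    by rewrite lerD2l lerN2 ler_nat cov.
  apply: (@le_trans _ _ #|[set k | u \in \bigcup_(j <- blocks k) bd j]|%:R); last by rewrite ler_nat.
  rewrite -sum1_card natr_sum [X in _ <= X]big_mkcond; apply: ler_sum => k _.
  by rewrite !inE; case: (u \in _).
rewrite big_split -!mulr_sumr /=.
have SG : \sum_u S u <= G * \sum_u D u.
  rewrite /S exchange_big mulr_sumr; apply: ler_sum => v _ /=.
  by rewrite -mulr_suml ler_wpM2r.
have H : m2%:R / #|K|%:R * \sum_u S u <= m2%:R / #|K|%:R * (G * \sum_u D u).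
  by rewrite ler_wpM2l // divr_ge0.
apply: (le_trans (lerD (lexx _) H)); rewrite le_eqVlt; apply/orP; left; apply/eqP.
by field; rewrite gt_eqF.
Qed.

Lemma iter_avgN_contr rho f : 0 <= rho -> (0 < #|T|)%N ->
  (forall f D, lip f D -> exists2 D', lip (avgN f) D' & \sum_u D' u <= rho * \sum_u D u) ->
  exists c, forall n s t, `|iter n avgN f s - iter n avgN f t| <= c * rho ^+ n.
Proof.
move=> rho0 T0 H; pose c := \sum_s `|f s|.
have fD : lip f (fun=> 2 * c).
  move=> v s t _; have b x : `|f x| <= c.
    by rewrite /c (bigD1 x) //= lerDl sumr_ge0.
  by apply: (le_trans (ler_normB _ _)); have := b s; have := b t; lra.
exists (\sum_(u : I) 2 * c) => n s t.
suff [D nD Dn] : exists2 D, lip (iter n avgN f) D &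
    \sum_u D u <= (\sum_(u : I) 2 * c) * rho ^+ n.
  by apply: le_trans Dn; exact: lip_total.
elim: n => [|n [D nD Dn]]; first by exists (fun=> 2 * c) => //; rewrite mulr1.
have [D' nD' Dn'] := H _ _ nD; exists D' => //; apply: (le_trans Dn').
by rewrite exprS mulrCA ler_wpM2l.
Qed.

End Lipschitz.

(** * Gibbs weights on the lattice *)

Section Lattice.
Import Order.TTheory GRing.Theory Num.Theory.
Local Open Scope ring_scope.
Variable d : nat.
Implicit Types (x y : Zd d) (V : seq (Zd d)).

Lemma nbrE x i b j : nbr x i b j = x j + unitv i b j.
Proof. by rewrite ffunE. Qed.

Lemma nbrK x i b : nbr (nbr x i b) i (~~ b) = x.
Proof.
by apply/ffunP => j; rewrite !nbrE !ffunE; case: eqP => _; case: b => /=; lia.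
Qed.

Lemma l1distC x y : l1dist x y = l1dist y x.
Proof. by rewrite /l1dist; apply: eq_bigr => i _; rewrite -[in RHS]abszN opprB. Qed.

Lemma l1dist_nbr x i b : l1dist x (nbr x i b) = 1%N.
Proof.
rewrite /l1dist (bigD1 i) //= nbrE ffunE eqxx big1 => [|j ji].
  by case: b; lia.
by rewrite nbrE ffunE (negbTE ji); lia.
Qed.

Lemma l1dist0 x : l1dist x x = 0%N.
Proof. by rewrite /l1dist big1 // => i _; rewrite subrr. Qed.

Lemma in_bdry_nbr V x i b : x \in V -> nbr x i b \notin V -> in_bdry V (nbr x i b).
Proof.
move=> xV nV; rewrite /in_bdry nV; apply/hasP; exists x => //.
by rewrite l1distC l1dist_nbr.
Qed.

End Lattice.

Lemma big_seq_sub (S : Type) (idx : S) (op : Monoid.com_law idx) (X : choiceType)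
    (V : seq X) (P : pred X) (F : X -> S) :
  \big[op/idx]_(v : seq_sub V | P (val v)) F (val v) =
  \big[op/idx]_(x <- undup V | P x) F x.
Proof.
rewrite -(big_map (fun v : seq_sub V => val v) P F); apply: perm_big.
apply: uniq_perm; rewrite ?undup_uniq ?map_inj_uniq ?index_enum_uniq //.
  exact: val_inj.
move=> x; rewrite mem_undup; apply/mapP/idP => [[v _ ->]|xV]; first exact: ssvalP.
by exists (SeqSub xV); rewrite ?mem_index_enum.
Qed.

Section GibbsWeight.
Import Order.TTheory GRing.Theory Num.Theory.
Local Open Scope ring_scope.

Variables (R : realType) (d q : nat).
Variables (vw : 'I_q -> R) (ew : 'I_q -> 'I_q -> R).
Hypothesis ew_sym : forall a b, ew a b = ew b a.
Hypothesis vw_gt0 : forall a, 0 < vw a.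
Hypothesis ew_ge0 : forall a b, 0 <= ew a b.
Implicit Types (V L : seq (Zd d)) (x y : Zd d) (t eta : Zd d -> 'I_q).

(** Configuration and boundary condition are merged into one total assignment [t], so that the
    weights of nested regions can be compared at the same argument. *)
Definition site_weight V t x : R := vw (t x) * \prod_(i < d)
  (ew (t x) (t (nbr x i true)) *
   (if nbr x i false \in V then 1 else ew (t x) (t (nbr x i false)))).

Definition weight V t : R := \prod_(v : seq_sub V) site_weight V t (val v).

Lemma weight_seq V t : weight V t = \prod_(x <- undup V) site_weight V t x.
Proof. exact: (big_seq_sub *%R V xpredT (site_weight V t)). Qed.

Lemma weight_ge0 V t : 0 <= weight V t.
Proof.
apply: prodr_ge0 => v _; apply: mulr_ge0; first exact: ltW. apply: prodr_ge0 => i _.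
by rewrite mulr_ge0 //; case: ifP.
Qed.

Lemma weight_local V t t' :
  (forall x, x \in V -> t x = t' x) -> (forall x, in_bdry V x -> t x = t' x) ->
  weight V t = weight V t'.
Proof.
move=> tt bt; apply: eq_bigr => -[x xV] _ /=; rewrite /site_weight tt //.
congr (_ * _); apply: eq_bigr => i _.
have N b : t (nbr x i b) = t' (nbr x i b).
  by case: (boolP (nbr x i b \in V)) => [/tt//|nV]; apply/bt/in_bdry_nbr.
by rewrite !N.
Qed.

(* Each edge between [V \ L] and [L] is charged to its endpoint in [V \ L] in the
   weight of [V] if it points forward, and to its endpoint in [L] in the weight
   of [L]; [ew_sym] identifies the two contributions. *)
Lemma weight_factor V L t : {subset L <= V} ->
  weight V t = weight L t * \prod_(x <- undup V | x \notin L) (vw (t x) *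
    \prod_(i < d) ((if nbr x i true \in L then 1 else ew (t x) (t (nbr x i true))) *
      (if nbr x i false \in V then 1 else ew (t x) (t (nbr x i false))))).
Proof.
move=> LV; rewrite !weight_seq (bigID (mem L)) /=.
pose c i x := if (nbr x i false \in V) && (nbr x i false \notin L)
  then ew (t x) (t (nbr x i false)) else 1.
pose c' i x := if nbr x i true \in L then ew (t x) (t (nbr x i true)) else 1.
have perm_L : perm_eq [seq x <- undup V | x \in L] (undup L).
  apply: uniq_perm; rewrite ?filter_uniq ?undup_uniq // => x.
  rewrite mem_filter !mem_undup; apply/andP/idP => [[]//|xL].
  by split=> //; exact: LV.
rewrite -big_filter (perm_big _ perm_L) /=.
have -> : \prod_(x <- undup L) site_weight L t x =
  \prod_(x <- undup L) site_weight V t x * \prod_(x <- undup L) \prod_(i < d) c i x.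
  rewrite -big_split; apply: eq_big_seq => x; rewrite mem_undup => xL /=.
  rewrite /site_weight -mulrA -big_split; congr (_ * _); apply: eq_bigr => i _ /=.
  rewrite -mulrA; congr (_ * _); rewrite /c.
  case: (boolP (nbr x i false \in L)) => [/LV ->|_]; rewrite ?andbF ?mulr1 //=.
  by case: ifP; rewrite ?mulr1 ?mul1r.
rewrite -mulrA; congr (_ * _).
have -> : \prod_(x <- undup L) \prod_(i < d) c i x =
   \prod_(x <- undup V | x \notin L) \prod_(i < d) c' i x.
  rewrite exchange_big [RHS]exchange_big; apply: eq_bigr => i _ /=.
  rewrite /c /c' -big_mkcond -big_mkcondr /=.
  rewrite -big_filter -[RHS]big_filter.
  rewrite (eq_bigr (fun x => ew (t (nbr x i false)) (t (nbr (nbr x i false) i true)))); last first.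
    by move=> x _; rewrite ew_sym (nbrK x i false).
  rewrite -(big_map (fun x => nbr x i false) xpredT (fun y => ew (t y) (t (nbr y i true)))).
  apply: perm_big; apply: uniq_perm.
  - rewrite map_inj_uniq ?filter_uniq ?undup_uniq //.
    exact: (can_inj (g := fun x => nbr x i true) (fun x => nbrK x i false)).
  - by rewrite filter_uniq ?undup_uniq.
  move=> y; rewrite mem_filter mem_undup; apply/mapP/idP => [[x]|].
    rewrite mem_filter mem_undup => /andP[/andP[xV xL'] xL] ->.
    by rewrite xL' xV (nbrK x i false) xL.
  move=> /andP[/andP[yL' yL] yV]; exists (nbr y i true); last by rewrite (nbrK y i true).
  by rewrite mem_filter mem_undup (nbrK y i true) yV yL' yL.
rewrite -big_split; apply: eq_bigr => x xL /=; rewrite mulrCA -big_split; congr (_ * _).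
apply: eq_bigr => i _ /=; rewrite mulrA; congr (_ * _); rewrite /c'.
by case: ifP; rewrite ?mulr1 ?mul1r.
Qed.

Definition tot V eta (s : Config V q) x : 'I_q :=
  if insub x is Some v then s v else eta x.

Lemma tot_val V eta (s : Config V q) (v : seq_sub V) : tot eta s (val v) = s v.
Proof. by rewrite /tot valK. Qed.

Lemma tot_out V eta (s : Config V q) x : x \notin V -> tot eta s x = eta x.
Proof. by move=> xV; rewrite /tot insubN. Qed.

(** The weight of the region [L] as a function of configurations on [V]; taking [L = V] gives the
    Gibbs weight itself. *)
Definition wconf V L eta (s : Config V q) : R := weight L (tot eta s).

Definition far V : rel (seq_sub V) := fun u v => (2 <= l1dist (val u) (val v))%N.

Lemma far_irr V (u : seq_sub V) : far u u = false.
Proof. by rewrite /far l1dist0. Qed.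

(** Each factor of the weight sees one site or two neighbours, which cannot meet both [A] and [B];
    hence each factor satisfies the exchange identity on its own. *)
Lemma exch_far V eta (A B : {set seq_sub V}) : sepset (@far V) A B ->
  exch (wconf V eta) A B.
Proof.
move=> /sepsetP AB s t s' t' st s't' ss' tt'.
have out (C : {set seq_sub V}) r r' x : agr C r r' ->
    (if insub x is Some v then v \notin C else true) -> tot eta r x = tot eta r' x.
  by move=> /agrP rr; rewrite /tot; case: insubP => // v _ _; exact: rr.
have two x y : (l1dist x y <= 1)%N ->
  (tot eta s x = tot eta t x /\ tot eta s y = tot eta t y /\
   tot eta s' x = tot eta t' x /\ tot eta s' y = tot eta t' y) \/
  (tot eta s x = tot eta s' x /\ tot eta s y = tot eta s' y /\
   tot eta t x = tot eta t' x /\ tot eta t y = tot eta t' y).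
  move=> xy.
  pose inn (C : {set seq_sub V}) z := if insub z is Some v then v \notin C else true.
  have key : (inn A x && inn A y) || (inn B x && inn B y).
    have M z z' : (l1dist z z' <= 1)%N -> ~~ inn A z -> inn B z'.
      rewrite /inn; case: insubP => // u _ uz; case: insubP => // v _ vz zz.
      rewrite negbK => uA; apply/negP => vB; have := AB u v uA vB.
      by rewrite /far uz vz leqNgt ltnS zz.
    case: (boolP (inn A x)) => [Ax|nAx] /=.
      case: (boolP (inn A y)) => //= nAy.
      rewrite (M y x) // 1?l1distC //=; apply: M nAy; by rewrite l1dist0.
    by rewrite (M x y) // (M x x) // l1dist0.
  case/orP: key => /andP[kx ky].
    left; rewrite (out _ _ _ x st kx) (out _ _ _ y st ky).
    by rewrite (out _ _ _ x s't' kx) (out _ _ _ y s't' ky).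
  right; rewrite (out _ _ _ x ss' kx) (out _ _ _ y ss' ky).
  by rewrite (out _ _ _ x tt' kx) (out _ _ _ y tt' ky).
rewrite /wconf /weight -!big_split; apply: eq_bigr => v _ /=.
rewrite /site_weight mulrACA [RHS]mulrACA -!big_split /=; congr (_ * _).
  by case: (two (val v) (val v)) => [|[-> [_ [-> _]]]|[-> [_ [-> _]]]] //;
    rewrite ?l1dist0 // mulrC.
apply: eq_bigr => i _; rewrite mulrACA [RHS]mulrACA; congr (_ * _).
  case: (two (val v) (nbr (val v) i true)) => [|[-> [-> [-> ->]]]|[-> [-> [-> ->]]]] //;
    by rewrite ?l1dist_nbr // mulrC.
case: ifP => // _.
case: (two (val v) (nbr (val v) i false)) => [|[-> [-> [-> ->]]]|[-> [-> [-> ->]]]] //;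
    by rewrite ?l1dist_nbr // mulrC.
Qed.

End GibbsWeight.

(** * Cubes inside a larger region *)

Section LocalChain.
Import Order.TTheory GRing.Theory Num.Theory.
Local Open Scope ring_scope.

Variables (R : realType) (d q : nat).
Variables (vw : 'I_q -> R) (ew : 'I_q -> 'I_q -> R).
Hypothesis ew_sym : forall a b, ew a b = ew b a.
Hypothesis vw_gt0 : forall a, 0 < vw a.
Hypothesis ew_ge0 : forall a b, 0 <= ew a b.
Variables (V L : seq (Zd d)) (eta : Zd d -> 'I_q).
Hypothesis LV : {subset L <= V}.
Implicit Types (s : Config V q) (tau : Config L q) (f : Config V q -> R).

Local Notation weight := (weight vw ew).
Local Notation w := (wconf vw ew V eta).
Local Notation wL := (wconf vw ew L eta).

Definition subsites : {set seq_sub V} := [set v | val v \in L].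
Definition bdsites : {set seq_sub V} := [set v | in_bdry L (val v)].

Definition glue s tau : Config V q :=
  [ffun v => if insub (val v) is Some u then tau u else s v].
Definition restr s : Config L q := [ffun u => tot eta s (val u)].
Definition incl (u : seq_sub L) : seq_sub V := SeqSub (LV (ssvalP u)).

Lemma glue_incl s tau u : glue s tau (incl u) = tau u.
Proof. by rewrite ffunE /= valK. Qed.

Lemma incl_inj : injective incl.
Proof. by move=> u v /(congr1 val) /= uv; exact: val_inj. Qed.

Lemma sum_incl (F : seq_sub V -> R) : \sum_(v in subsites) F v = \sum_u F (incl u).
Proof.
have -> : subsites = [set incl u | u in [set: seq_sub L]].
  apply/setP => v; rewrite inE; apply/idP/imsetP => [vL|[u _ ->]]; last exact: ssvalP.
  by exists (SeqSub vL) => //; exact: val_inj.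
rewrite big_imset /=; last by move=> u v _ _; exact: incl_inj.
by apply: eq_bigl => u; rewrite inE.
Qed.

Lemma agr_glue s tau : agr subsites s (glue s tau).
Proof. by apply/agrP => v; rewrite inE ffunE => vL; rewrite insubN. Qed.

Lemma glue_restr s s' : agr subsites s s' -> glue s (restr s') = s'.
Proof.
move=> /agrP ss; apply/ffunP => v; rewrite ffunE.
case: insubP => [u _ uv|vL]; last by apply: ss; rewrite inE.
by rewrite ffunE uv tot_val.
Qed.

Lemma restr_glue s tau : restr (glue s tau) = tau.
Proof. by apply/ffunP => u; rewrite ffunE -[val u]/(val (incl u)) tot_val glue_incl. Qed.

Lemma tot_glue s tau : tot eta (glue s tau) = tot (tot eta s) tau.
Proof.
apply: funext => x; rewrite /tot; case: insubP => [v _ <-|xV].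
  by rewrite ffunE; case: insubP => // _; rewrite valK.
by rewrite insubN //; apply: contra xV; exact: LV.
Qed.

Lemma glue_agr s s' tau A : agr A s s' -> agr A (glue s tau) (glue s' tau).
Proof. by move=> /agrP ss; apply/agrP => v vA; rewrite !ffunE; case: insubP => //=; rewrite ss. Qed.

Lemma glue_agr_in s tau tau' u : agr [set u] tau tau' ->
  agr [set incl u] (glue s tau) (glue s tau').
Proof.
move=> /agrP tt; apply/agrP => v; rewrite inE !ffunE => vu.
case: insubP => // u' _ uv; apply: tt; rewrite inE; apply: contra vu => /eqP <-.
by apply/eqP/val_inj; rewrite /= uv.
Qed.

Lemma sum_class s (F : Config V q -> R) :
  \sum_(t | agr subsites s t) F t = \sum_tau F (glue s tau).
Proof.
rewrite (reindex_onto (glue s) restr) => [|t]; last exact: glue_restr.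
by apply: eq_bigl => tau; rewrite agr_glue restr_glue eqxx.
Qed.

Lemma card_class s : #|[set t | agr subsites s t]| = #|{: Config L q}|.
Proof.
have -> : [set t | agr subsites s t] = [set glue s tau | tau : Config L q].
  apply/setP => t; rewrite inE; apply/idP/imsetP => [st|[tau _ ->]]; last exact: agr_glue.
  by exists (restr t); rewrite ?glue_restr.
by rewrite card_imset //; apply: (can_inj (restr_glue s)).
Qed.

Lemma wL_glue s tau : wL (glue s tau) = weight L (tot (tot eta s) tau).
Proof. by rewrite /wconf tot_glue. Qed.

Lemma wconf_factor s : {c | 0 <= c & forall t, agr subsites s t -> w t = c * wL t}.
Proof.
exists (\prod_(x <- undup V | x \notin L) (vw (tot eta s x) *
    \prod_(i < d) ((if nbr x i true \in L then 1 else ew (tot eta s x) (tot eta s (nbr x i true))) *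
      (if nbr x i false \in V then 1 else ew (tot eta s x) (tot eta s (nbr x i false)))))).
  apply: prodr_ge0 => x _; apply: mulr_ge0; first exact: ltW.
  by apply: prodr_ge0 => i _; apply: mulr_ge0; case: ifP.
move=> t /agrP st; rewrite /wconf (weight_factor _ ew_sym _ LV) mulrC; congr (_ * _).
have out x : x \notin L -> tot eta t x = tot eta s x.
  by move=> xL; rewrite /tot; case: insubP => // v _ vx; rewrite st // inE vx.
apply: eq_bigr => x xL; rewrite out //; congr (_ * _); apply: eq_bigr => i _.
congr (_ * _); case: ifP => // xi; first by rewrite out // xi.
by rewrite out //; apply/negP => /LV; rewrite xi.
Qed.

Lemma wconf_neq0 s : w s != 0 ->
  {c | 0 < c & forall t, agr subsites s t -> w t = c * wL t}.
Proof.
move=> ws; have [c c0 H] := wconf_factor s; exists c => //.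
rewrite lt_def c0 andbT; apply: contraNneq ws => c00.
by rewrite H ?agr_refl // c00 mul0r.
Qed.

(** The Markov property: the part of the weight outside [L] is a constant on the class and cancels.
    Validity of [s] makes this constant nonzero. *)
Lemma hb_local f s : w s != 0 -> hb w subsites f s = hb wL subsites f s.
Proof.
move=> /wconf_neq0[c c0 H]; rewrite /hb.
rewrite (eq_bigr (fun t => c * (wL t * f t))) => [|t st]; last by rewrite H ?mulrA.
rewrite [X in _ / X](eq_bigr (fun t => c * wL t)) // -!mulr_sumr invfM mulrACA.
by rewrite divff ?mul1r // gt_eqF.
Qed.

(** * Influence of a boundary site on a resampled cube *)

Section Mixing.
Hypothesis Zpos : forall eta', 0 < \sum_(tau : Config L q) weight L (tot eta' tau).

Definition gibbsR (eta' : Zd d -> 'I_q) tau : R :=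
  weight L (tot eta' tau) / \sum_(tau' : Config L q) weight L (tot eta' tau').

Lemma gibbsR_ge0 eta' tau : 0 <= gibbsR eta' tau.
Proof. by rewrite divr_ge0 ?weight_ge0 // ltW. Qed.

Lemma sum_gibbsR eta' : \sum_tau gibbsR eta' tau = 1.
Proof. by rewrite -mulr_suml divff // gt_eqF. Qed.

Lemma hb_gibbsR f s : hb wL subsites f s = \sum_tau gibbsR (tot eta s) tau * f (glue s tau).
Proof.
rewrite /hb !sum_class mulr_suml; apply: eq_bigr => tau _.
rewrite /gibbsR wL_glue mulrAC; congr (_ / _ * _).
by apply: eq_bigr => tau' _; rewrite wL_glue.
Qed.

Variable beta : nat -> R.
Hypothesis mixing : forall u, in_bdry L u -> forall eta1 eta2,
  (forall x, in_bdry L x -> x <> u -> eta1 x = eta2 x) ->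
  forall k, \sum_r `|mar (gibbsR eta1) (B := [set v | (k <= l1dist u (val v))%N]) r
                      - mar (gibbsR eta2) r| <= beta k.

(* [hb wL] is a probability kernel from every configuration, valid or not: this allows
   changing one site at a time through configurations of weight zero. *)
Lemma lip_hb_local f D : lip f D ->
  lip (hb wL subsites f) (fun u => (u \notin subsites)%:R * D u +
    (u \in bdsites)%:R * \sum_(v in subsites) beta (l1dist (val u) (val v)) * D v).
Proof.
move=> fD u s s' ss.
have D0 v : 0 <= D v by exact: lip_ge0 s fD.
(* Comparing a boundary condition with itself shows [beta] nonnegative as soon as there is a
   boundary site. *)
have beta0 k : (exists x, in_bdry L x) -> 0 <= beta k.
  case=> x /mixing/(_ eta eta (fun _ _ _ => erefl) k); apply: le_trans.
  by apply: sumr_ge0.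
have S0 : 0 <= (u \in bdsites)%:R * \sum_(v in subsites) beta (l1dist (val u) (val v)) * D v.
  case: (boolP (u \in bdsites)) => [ub|_]; last by rewrite mul0r.
  rewrite mul1r; apply: sumr_ge0 => v _; rewrite mulr_ge0 // beta0 //.
  by exists (val u); rewrite inE in ub.
case: (boolP (u \in subsites)) => uL /=.
  rewrite (@hb_class _ _ _ _ _ _ s s') ?subrr ?normr0 ?mul0r ?add0r //.
  by apply: agr_sub ss; rewrite sub1set.
rewrite mul1r !hb_gibbsR.
have -> : \sum_tau gibbsR (tot eta s) tau * f (glue s tau) -
    \sum_tau gibbsR (tot eta s') tau * f (glue s' tau) =
    \sum_tau gibbsR (tot eta s) tau * (f (glue s tau) - f (glue s' tau)) +
   (\sum_tau gibbsR (tot eta s) tau * f (glue s' tau) -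
    \sum_tau gibbsR (tot eta s') tau * f (glue s' tau)).
  rewrite addrA; congr (_ - _); rewrite -big_split; apply: eq_bigr => tau _ /=; ring.
apply: (le_trans (ler_normD _ _)); apply: lerD.
  apply: (le_trans (ler_norm_sum _ _ _)).
  rewrite -[X in _ <= X]mul1r -(sum_gibbsR (tot eta s)) mulr_suml.
  apply: ler_sum => tau _; rewrite normrM (ger0_norm (gibbsR_ge0 _ _)).
  by rewrite ler_wpM2l ?gibbsR_ge0 //; apply/fD/glue_agr.
have tots x : x <> val u -> tot eta s x = tot eta s' x.
  move=> xu; rewrite /tot; case: insubP => // v _ vx; apply: (agrP _ _ _ ss).
  by rewrite inE; apply/eqP => vu; apply: xu; rewrite -vx vu.
case: (boolP (u \in bdsites)) => ub; last first.
  rewrite mul0r (eq_bigr (fun tau => gibbsR (tot eta s') tau * f (glue s' tau))) ?subrr ?normr0 //.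
  have W tau : weight L (tot (tot eta s) tau) = weight L (tot (tot eta s') tau).
    apply: weight_local => x xL; first by rewrite /tot; case: insubP => //; rewrite xL.
    have xnL : x \notin L by case/andP: xL.
    rewrite !(@tot_out _ _ L) //.
    by apply: tots => xu; move: ub; rewrite inE -xu xL.
  move=> tau _; rewrite /gibbsR W; congr (_ / _ * _); apply: eq_bigr => tau' _; exact: W.
rewrite mul1r.
have fD' : lip (fun tau => f (glue s' tau)) (fun v => D (incl v)).
  by move=> v t t' tt; apply/fD/glue_agr_in.
rewrite inE in ub.
rewrite sum_incl; apply: (@marginals_lip _ _ _ (gibbsR (tot eta s)) (gibbsR (tot eta s'))
  (fun v => l1dist (val u) (val v)) beta (restr s) _ _ _ _ fD').
  by rewrite !sum_gibbsR.
by move=> k; apply: mixing => // x _; exact: tots.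
Qed.
End Mixing.

(** * Poincare inequality in a region of bounded size *)

Section Energy.

(** A path without repetition has at most [#|X|] steps. Increments are controlled only at points
    reachable from [x], because in the application only these are known to be valid. *)
Lemma connect_lip (X : finType) (e : rel X) (F : X -> R) (c : R) x y :
  0 <= c -> (forall a b, connect e x a -> e a b -> `|F a - F b| <= c) ->
  connect e x y -> `|F x - F y| <= #|X|%:R * c.
Proof.
move=> c0 H /connectP[p0 ep0 ->{y}]; case/shortenP: ep0 => p ep up _ {p0}.
have sz : (size p <= #|X|)%N.
  by have := max_card (mem (x :: p)); rewrite (card_uniqP up) => /ltnW.
suff B : `|F x - F (last x p)| <= (size p)%:R * c.
  by apply: (le_trans B); rewrite ler_wpM2r // ler_nat.
elim: p x H ep {up sz} => [|y p IH] x H /=; first by rewrite subrr normr0 mul0r.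
move=> /andP[xy yp]; rewrite -(subrKA (F y)); apply: (le_trans (ler_normD _ _)).
rewrite -natr1 mulrDl mul1r addrC; apply: lerD; last exact: H (connect0 _ _) xy.
by apply: IH => // a b ya; apply: H; apply: connect_trans ya; exact: connect1.
Qed.

Lemma hb_osc A f s c : w s != 0 ->
  (forall t, agr A s t -> w t != 0 -> `|f s - f t| <= c) -> `|f s - hb w A f s| <= c.
Proof.
move=> ws fc; have w_ge0 (t : Config V q) : 0 <= w t by apply: weight_ge0.
have Zs := hbw_gt0 w_ge0 A ws.
have -> : f s - hb w A f s =
    (\sum_(t | agr A s t) w t * (f s - f t)) / \sum_(t | agr A s t) w t.
  rewrite (eq_bigr (fun t => w t * f s - w t * f t)) => [|t _]; last by rewrite mulrBr.
  by rewrite sumrB -mulr_suml mulrBl mulrAC divff ?mul1r // gt_eqF.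
rewrite normrM normfV (gtr0_norm Zs) ler_pdivrMr //.
apply: (le_trans (ler_norm_sum _ _ _)); rewrite mulr_sumr; apply: ler_sum => t st.
rewrite normrM ger0_norm ?w_ge0 // mulrC.
have [->|wt] := eqVneq (w t) 0; first by rewrite !mulr0.
by rewrite ler_wpM2r ?w_ge0 // fc.
Qed.

Variable H : R.
(** Two-sided control of a positive number; [k] counts the factors of a product, so that bounds
    depend only on the number of sites. *)
Definition bounded_by k (x : R) := (x <= H ^+ k) && (x^-1 <= H ^+ k).
Hypothesis H_ge1 : 1 <= H.
Hypothesis vwH : forall a, bounded_by 1 (vw a).
Hypothesis ewH : forall a b, ew a b != 0 -> bounded_by 1 (ew a b).

Lemma bounded_by1 : bounded_by 1 1.
Proof. by rewrite /bounded_by invr1 H_ge1. Qed.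

Lemma bounded_byM k l x y : 0 < x -> 0 < y ->
  bounded_by k x -> bounded_by l y -> bounded_by (k + l) (x * y).
Proof.
move=> x0 y0 /andP[x1 x2] /andP[y1 y2]; rewrite /bounded_by exprD invfM.
by apply/andP; split; apply: ler_pM; rewrite ?invr_ge0 // ltW.
Qed.

Lemma bounded_by_le k l x : (k <= l)%N -> bounded_by k x -> bounded_by l x.
Proof.
move=> kl /andP[x1 x2]; have Hkl := ler_weXn2l H_ge1 kl.
by rewrite /bounded_by (le_trans x1) // (le_trans x2).
Qed.

Lemma bounded_by_prod (X : finType) (F : X -> R) k :
  (forall i, 0 < F i) -> (forall i, bounded_by k (F i)) ->
  bounded_by (#|X| * k) (\prod_i F i).
Proof.
move=> F0 Fk; rewrite cardE -big_enum /=.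
elim: (enum X) => [|i r IH]; first by rewrite big_nil /bounded_by invr1 expr0 lexx.
by rewrite big_cons mulSn; apply: bounded_byM => //; apply: prodr_gt0.
Qed.

(** Each site brings one vertex factor and two edge factors per direction. *)
Lemma weight_bounded t : weight L t != 0 ->
  bounded_by (#|{: seq_sub L}| * (1 + d * 2)) (weight L t).
Proof.
move=> /prodf_neq0 W; have pos a b : ew a b != 0 -> 0 < ew a b.
  by rewrite lt_def ew_ge0 andbT.
have key (v : seq_sub L) : 0 < site_weight vw ew L t (val v) /\
    bounded_by (1 + d * 2) (site_weight vw ew L t (val v)).
  have := W v isT; rewrite /site_weight mulf_eq0 negb_or => /andP[_ /prodf_neq0 E].
  have F i : 0 < ew (t (val v)) (t (nbr (val v) i true)) *
      (if nbr (val v) i false \in L then 1 else ew (t (val v)) (t (nbr (val v) i false))) /\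
    bounded_by 2 (ew (t (val v)) (t (nbr (val v) i true)) *
      (if nbr (val v) i false \in L then 1 else ew (t (val v)) (t (nbr (val v) i false)))).
    have := E i isT; rewrite mulf_eq0 negb_or => /andP[e1 e2].
    have e1p := pos _ _ e1; case: ifP e2 => _ e2.
      by split; [rewrite mulr1|apply: (@bounded_byM 1 1) => //; [exact: ewH|exact: bounded_by1]].
    have e2p := pos _ _ e2.
    by split; [rewrite mulr_gt0|apply: (@bounded_byM 1 1) => //; exact: ewH].
  have P : 0 < \prod_(i < d) (ew (t (val v)) (t (nbr (val v) i true)) *
      (if nbr (val v) i false \in L then 1 else ew (t (val v)) (t (nbr (val v) i false)))).
    by apply: prodr_gt0 => i _; case: (F i).
  split; first by rewrite mulr_gt0.
  apply: bounded_byM => //; rewrite -[X in bounded_by (X * _)]card_ord.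
  by apply: bounded_by_prod => i; case: (F i).
by apply: bounded_by_prod => v; case: (key v).
Qed.

Hypothesis q_gt0 : (0 < q)%N.
Hypothesis irred : forall eta' tau tau',
  weight L (tot eta' tau) != 0 -> weight L (tot eta' tau') != 0 ->
  connect (fun a b : Config L q => [exists v, agr [set v] a b && (weight L (tot eta' b) != 0)])
    tau tau'.

Variables (n : nat) (E : {set seq_sub V}).
Hypothesis cardL : (#|{: seq_sub L}| <= n)%N.

(** The 4 comes from comparing two values through a common conditional mean; two powers of [q ^ n]
    are the squared path length and the third is the size of a class; the power of [H] bounds the
    ratio of two weights in a class. *)
Definition energy_const : R := 4 * (q ^ n)%:R ^+ 3 * H ^+ (n * (1 + d * 2)) ^+ 2.

Lemma energy_const_gt0 : 0 < energy_const.
Proof.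
by rewrite !mulr_gt0 ?exprn_gt0 ?ltr0n ?expn_gt0 ?q_gt0 // (lt_le_trans ltr01).
Qed.

Lemma class_ratio s t : agr subsites s t -> w s != 0 -> w t != 0 ->
  w s <= H ^+ (n * (1 + d * 2)) ^+ 2 * w t.
Proof.
move=> st ws wt; have [c c0 Hc] := wconf_neq0 ws.
have B r : agr subsites s r -> w r != 0 -> 0 < wL r /\
    bounded_by (n * (1 + d * 2)) (wL r).
  move=> sr wr; have wLr : wL r != 0 by apply: contraNneq wr => w0; rewrite Hc ?w0 ?mulr0.
  split; first by rewrite lt_def wLr /wconf weight_ge0.
  by apply: bounded_by_le (weight_bounded wLr); rewrite leq_mul2r cardL orbT.
have [_ /andP[s1 _]] := B s (agr_refl _ _) ws; have [t0 /andP[_ t2]] := B t st wt.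
rewrite !Hc ?agr_refl // mulrCA ler_pM2l // expr2 -mulrA; apply: (le_trans s1).
rewrite ler_peMr ?exprn_ge0 ?(le_trans ler01) //.
by rewrite -ler_pdivrMr // mul1r.
Qed.

Local Notation defect A f := (fun s => (f s - hb w A f s) ^+ 2).

(* Any two valid configurations of the class are joined by a path of single-site
   moves inside it; each move stays in a class of one of the two sublattices, and
   all weights in the class are comparable. *)
Lemma local_energy f : nrm w (f \- hb w subsites f) <= energy_const *
  (nrm w (f \- hb w (subsites :&: E) f) + nrm w (f \- hb w (subsites :\: E) f)).
Proof.
pose e s := defect (subsites :&: E) f s + defect (subsites :\: E) f s.
have e_ge0 s : 0 <= e s by rewrite addr_ge0 // sqr_ge0.
have w_ge0 s : 0 <= w s by apply: weight_ge0.
pose S s := \sum_(r | agr subsites s r && (w r != 0)) e r.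
have S_ge0 s : 0 <= S s by apply: sumr_ge0.
have step s t t' v : v \in subsites -> agr subsites s t -> agr subsites s t' ->
    w t != 0 -> w t' != 0 -> agr [set v] t t' -> `|f t - f t'| <= Num.sqrt (4 * S s).
  move=> vL st st' wt wt' tt; rewrite -sqrtr_sqr ler_wsqrtr //.
  have eS r : agr subsites s r -> w r != 0 -> e r <= S s.
    by move=> sr wr; rewrite /S (bigD1 r) ?sr //= lerDl sumr_ge0.
  have A_bound (A : {set seq_sub V}) : v \in A -> (forall r, (f r - hb w A f r) ^+ 2 <= e r) ->
      (f t - f t') ^+ 2 <= 4 * S s.
    (* A move at a site of [A] does not change [hb w A f], so both values of [f] are compared with
       the same number. *)
    move=> vA Ae; have hA : hb w A f t = hb w A f t'.
      by apply: hb_class; apply: agr_sub tt; rewrite sub1set.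
    have := le_trans (Ae t) (eS t st wt); have := le_trans (Ae t') (eS t' st' wt').
    rewrite hA; move: (hb w A f t') => z; have := sqr_ge0 ((f t - z) + (f t' - z)).
    have -> : (f t - f t') ^+ 2 = 2 * (f t - z) ^+ 2 + 2 * (f t' - z) ^+ 2 -
       ((f t - z) + (f t' - z)) ^+ 2 by ring.
    lra.
  case: (boolP (v \in E)) => vE.
    apply: (A_bound (subsites :&: E)) => [|r]; first by rewrite inE vL.
    by rewrite /e lerDl sqr_ge0.
  apply: (A_bound (subsites :\: E)) => [|r]; first by rewrite inE vL vE.
  by rewrite /e lerDr sqr_ge0.
have cardC : (#|{: Config L q}| <= q ^ n)%N.
  by rewrite card_ffun card_ord leq_pexp2l.
have ptw s : w s != 0 -> (f s - hb w subsites f s) ^+ 2 <= (q ^ n)%:R ^+ 2 * (4 * S s).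
  move=> ws; have [c c0 Hc] := wconf_neq0 ws.
  have wgl tau : (w (glue s tau) != 0) = (weight L (tot (tot eta s) tau) != 0).
    by rewrite (Hc _ (agr_glue s tau)) wL_glue mulf_eq0 (gt_eqF c0).
  have osc : `|f s - hb w subsites f s| <= (q ^ n)%:R * Num.sqrt (4 * S s).
    apply: hb_osc => // t st wt.
    have := glue_restr st; have := glue_restr (agr_refl subsites s) => gs gt.
    rewrite -{1}gs -gt; apply: (@le_trans _ _ (#|{: Config L q}|%:R * Num.sqrt (4 * S s))); last first.
      by rewrite ler_wpM2r ?sqrtr_ge0 // ler_nat.
    have Ws : weight L (tot (tot eta s) (restr s)) != 0 by rewrite -wgl gs.
    apply: (connect_lip (F := fun tau => f (glue s tau))) (irred Ws _); last by rewrite -wgl gt.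
      by rewrite sqrtr_ge0.
    move=> a b ca /existsP[v /andP[ab Wb]].
    (* A reachable point is either the valid start or the target of a step, and targets are
       valid. *)
    have Wa : weight L (tot (tot eta s) a) != 0.
      case/connectP: ca => p; case/lastP: p => [_ -> //|p z].
      by rewrite rcons_path last_rcons => /andP[_ /existsP[? /andP[_ Wz]]] ->.
    apply: (step s _ _ (incl v)); rewrite ?agr_glue ?wgl //; first by rewrite inE; exact: ssvalP.
    exact: glue_agr_in.
  rewrite -real_normK ?num_real // -[4 * S s]sqr_sqrtr ?mulr_ge0 // -exprMn.
  by rewrite lerXn2r // nnegrE ?mulr_ge0 ?sqrtr_ge0.
have -> : nrm w (f \- hb w (subsites :&: E) f) + nrm w (f \- hb w (subsites :\: E) f)
    = \sum_s w s * e s.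
  by rewrite -big_split; apply: eq_bigr => s _; rewrite /e /=; ring.
set h := H ^+ (n * (1 + d * 2)) ^+ 2.
have h0 : 0 <= h by rewrite !exprn_ge0 // (le_trans ler01).
have c0 : 0 <= 4 * (q ^ n)%:R ^+ 2 :> R by rewrite mulr_ge0 ?exprn_ge0 ?ler0n.
have t0 r : 0 <= 4 * (q ^ n)%:R ^+ 2 * h * (w r * e r) by rewrite mulr_ge0 // mulr_ge0.
apply: (@le_trans _ _ (\sum_s \sum_(r | agr subsites s r)
     4 * (q ^ n)%:R ^+ 2 * h * (w r * e r))).
  apply: ler_sum => s _; have [->|ws] := eqVneq (w s) 0.
    by rewrite mul0r; apply: sumr_ge0.
  rewrite -expr2; apply: (le_trans (ler_wpM2l (w_ge0 s) (ptw s ws))).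
  rewrite /S !mulr_sumr (bigID (fun r => w r != 0) (agr subsites s)) /=.
  apply: ler_wpDr; first by apply: sumr_ge0.
  apply: ler_sum => r /andP[sr wr].
  have -> : w s * ((q ^ n)%:R ^+ 2 * (4 * e r)) = 4 * (q ^ n)%:R ^+ 2 * (w s * e r) by ring.
  rewrite -[X in _ <= X]mulrA ler_wpM2l // mulrA ler_wpM2r //.
  exact: class_ratio.
(* After the exchange each [r] is counted once per member of its class, whence the last factor
   [q ^ n]. *)
rewrite (exchange_big_dep xpredT) //= mulr_sumr; apply: ler_sum => r _.
rewrite (eq_bigl (fun s => s \in [set s | agr subsites r s])) => [|s]; last first.
  by rewrite inE agr_sym.
have we0 : 0 <= w r * e r by rewrite mulr_ge0.
move: (w r * e r) we0 => z z0; rewrite sumr_const card_class -[X in X <= _]mulr_natl mulrA ler_wpM2r //.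
rewrite /energy_const -/h.
have -> : 4 * (q ^ n)%:R ^+ 3 * h = (q ^ n)%:R * (4 * (q ^ n)%:R ^+ 2 * h) by ring.
by rewrite ler_wpM2r ?ler_nat // mulr_ge0.
Qed.

End Energy.
End LocalChain.

(** * Tilings of a cube *)

Section Cubes.
Import Order.TTheory GRing.Theory Num.Theory.
Local Open Scope ring_scope.
Variable d : nat.
Implicit Types (x y c : Zd d).

Lemma vaddE x y i : vadd x y i = x i + y i.
Proof. by rewrite ffunE. Qed.

Lemma in_cube c s x : reflect (forall i, c i <= x i < c i + s%:Z) (x \in cube c s).
Proof.
apply: (iffP imageP) => [[y _ ->] i|H].
  by rewrite vaddE ffunE; have := ltn_ord (y i); move: (nat_of_ord (y i)) => m; lia.
have b i : (absz (x i - c i) < s)%N by have := H i; lia.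
exists [ffun i => Ordinal (b i)] => //; apply/ffunP => i; rewrite vaddE !ffunE /=.
by have := H i; lia.
Qed.

Lemma card_cube c s : (#|{: seq_sub (cube c s)}| <= s ^ d)%N.
Proof.
have -> : (s ^ d = size (cube c s))%N by rewrite size_map -cardE card_ffun !card_ord.
apply: leq_trans (size_undup _); rewrite -sum1_card.
by rewrite (big_seq_sub addn (cube c s) xpredT (fun _ => 1%N)) sum1_size.
Qed.

Lemma l1dist_ge x y i : (absz (x i - y i) <= l1dist x y)%N.
Proof. by rewrite /l1dist (bigD1 i) //= leq_addr. Qed.

Lemma cube_bdry c s x : (0 < s)%N -> in_bdry (cube c s) x ->
  exists i, x i + 1 = c i \/ x i = c i + s%:Z.
Proof.
move=> s0 /andP[/negP xc /hasP[v /in_cube vc /eqP xv]].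
have /existsNP[i xi] : ~ forall i, c i <= x i < c i + s%:Z by move/in_cube.
exists i; have := l1dist_ge x v i; rewrite xv; have := vc i; move: xi; lia.
Qed.

End Cubes.

Section Tiling.
Import Order.TTheory GRing.Theory Num.Theory.
Local Open Scope nat_scope.
Variables (d : nat) (a : Zd d) (L l : nat).
Hypothesis l_gt0 : 0 < l.
Hypothesis lL : 2 * l <= L.

(* Blocks start in the lattice [k + 6 l Z], shifted by [- 2 l] so that truncated
   subtraction clamps them at 0, and are clamped at [L - s] on the other side. The
   side [s] must vary as well: a clamped cube would otherwise always have the same
   boundary. *)
Definition tstart s k j := minn (k + 6 * l * j - 2 * l) (L - s).
(** Blocks starting beyond the box are dropped: clamping would place them all at [L - s]. *)
Definition tactive k j := k + 6 * l * j - 2 * l < L.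

(** The period [6 * l] absorbs the truncation at 0, a side below [2 * l], and a push-back at the far
    end by less than one side. Strictness leaves a free site between consecutive blocks. *)
Lemma tstart_sep s k j j' : l <= s < 2 * l -> k < 6 * l -> j < j' ->
  tactive k j -> tactive k j' -> tstart s k j + s < tstart s k j'.
Proof.
move=> sl kl jj; have : 6 * l * j + 6 * l <= 6 * l * j'.
  by rewrite addnC -mulnS leq_mul2l jj orbT.
rewrite /tactive /tstart; move: (6 * l * j) (6 * l * j') => m m'; lia.
Qed.

(** For every offset [t < l], Euclidean division selects the block with unclamped start [y - t]. It
    covers [y] because the side is at least [l], and clamping keeps [y] inside. *)
Lemma tstart_cover s y t : l <= s < 2 * l -> y < L -> t < l ->
  let k := (y + 2 * l - t) %% (6 * l) in let j := (y + 2 * l - t) %/ (6 * l) in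
  [/\ tactive k j, j < L & tstart s k j <= y < tstart s k j + s].
Proof.
move=> sl yL tl k j; have E : k + 6 * l * j = y + 2 * l - t.
  by rewrite addnC mulnC -divn_eq.
split; rewrite /tactive /tstart ?E; try lia.
rewrite ltn_divLR; nia.
Qed.

(** An unclamped start is determined by [y] and the side, which fixes [k] modulo [6 * l]; for a
    block clamped at the far end or at 0, it is the side that [y] determines. *)
Lemma tstart_bdry s k j y : l <= s < 2 * l -> k < 6 * l -> y < L -> tactive k j ->
  y.+1 = tstart s k j \/ y = tstart s k j + s ->
  [|| s == L.-1 - y, s == y, k == (y.+1 + 2 * l) %% (6 * l) |
      k == (y - s + 2 * l) %% (6 * l)].
Proof.
move=> sl kl yL; rewrite /tactive /tstart.
have M z : k + 6 * l * j = z -> k = z %% (6 * l).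
  by move=> <-; rewrite addnC mulnC modnMDl modn_small.
have := M (y.+1 + 2 * l); have := M (y - s + 2 * l).
move: (6 * l * j) (_ %% _) (_ %% _) => m p p' M1 M2 act; lia.
Qed.

(** Index of a family: the excess of the common side over [l], and the offset of the blocks in each
    direction. *)
Definition tindex := ('I_l * {ffun 'I_d -> 'I_(6 * l)})%type.
Definition tside (k : tindex) := l + k.1.
Definition tblock := (tindex * {ffun 'I_d -> 'I_L})%type.
Definition tblocks (k : tindex) : seq tblock :=
  [seq (k, j) | j in [pred j : {ffun 'I_d -> 'I_L} | [forall i, tactive (k.2 i) (j i)]]].
Definition tcorner (b : tblock) : Zd d :=
  vadd a [ffun i => Posz (tstart (tside b.1) (b.1.2 i) (b.2 i))].
Definition tcube (b : tblock) : seq (Zd d) := cube (tcorner b) (tside b.1).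

Lemma tside_bd k : l <= tside k < 2 * l.
Proof. by rewrite /tside; have := ltn_ord k.1; lia. Qed.

Lemma tblocks_uniq k : uniq (tblocks k).
Proof. by rewrite map_inj_uniq ?enum_uniq // => x y []. Qed.

Lemma tblocksP k b : b \in tblocks k ->
  b.1 = k /\ forall i, tactive (k.2 i) (b.2 i).
Proof. by case/imageP => j; rewrite inE => /forallP H ->. Qed.

Lemma in_tcube k (j : {ffun 'I_d -> 'I_L}) (x : Zd d) : reflect
  (forall i, (a i + (tstart (tside k) (k.2 i) (j i))%:Z <= x i <
     a i + (tstart (tside k) (k.2 i) (j i))%:Z + (tside k)%:Z)%R)
  (x \in tcube (k, j)).
Proof. by apply: (iffP (in_cube _ _ _)) => H i; have := H i; rewrite vaddE ffunE. Qed.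

Lemma tcube_sub b : {subset tcube b <= cube a L}.
Proof.
case: b => k j x /in_tcube xb; apply/in_cube => i; have := xb i.
have := tside_bd k; rewrite /tstart; move: (tside k) (_ - 2 * l) => s m; lia.
Qed.

Lemma tcube_far_aux (k : tindex) (j j' : {ffun 'I_d -> 'I_L}) (x y : Zd d) (i : 'I_d) :
  tactive (k.2 i) (j i) -> tactive (k.2 i) (j' i) -> j i < j' i ->
  x \in tcube (k, j) -> y \in tcube (k, j') -> 2 <= l1dist x y.
Proof.
move=> ab ab' jj /in_tcube /(_ i) xb /in_tcube /(_ i) yb.
apply: leq_trans (l1dist_ge x y i); move: xb yb.
have := tstart_sep (tside_bd k) (ltn_ord (k.2 i)) jj ab ab'.
by move: (tside k) (tstart _ _ (j i)) (tstart _ _ (j' i)) => s p p'; lia.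
Qed.

Lemma tcube_far k b b' (x y : Zd d) : b \in tblocks k -> b' \in tblocks k -> b != b' ->
  x \in tcube b -> y \in tcube b' -> 2 <= l1dist x y.
Proof.
case: b b' => [k1 j] [k2 j'] /tblocksP[/= -> ab] /tblocksP[/= -> ab'] {k1 k2} bb xb yb.
have [i ji] : exists i, j i != j' i.
  apply/existsP; rewrite -negb_forall; apply: contra bb => /forallP H.
  by apply/eqP; congr pair; apply/ffunP => i; apply/eqP.
case: (ltngtP (j i) (j' i)) => jj; last by move: ji; rewrite (val_inj jj) eqxx.
  exact: tcube_far_aux (ab i) (ab' i) jj xb yb.
by rewrite l1distC; exact: tcube_far_aux (ab' i) (ab i) jj yb xb.
Qed.

(** Any of the [l] sides and any of the [l ^ d] positions of [x] relative to the start of its block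
    yield a family, and distinct ones since the positions stay below the period. *)
Lemma tcover (x : Zd d) : x \in cube a L ->
  l ^ d.+1 <= #|[set k : tindex | has (fun b => x \in tcube b) (tblocks k)]|.
Proof.
move=> /in_cube xV; have l6 : 0 < 6 * l by rewrite muln_gt0.
pose y i := absz (x i - a i)%R.
have yL i : y i < L by have := xV i; rewrite /y; lia.
pose phi (p : 'I_l * {ffun 'I_d -> 'I_l}) : tindex :=
  (p.1, [ffun i => Ordinal (ltn_pmod (y i + 2 * l - p.2 i) l6)]).
have phi_inj : injective phi.
  move=> [s t] [s' t'] /= [-> /ffunP tt]; congr pair; apply/ffunP => i.
  have := tt i; rewrite !ffunE => /(congr1 val) /= E; apply: val_inj => /=.
  have := divn_eq (y i + 2 * l - t i) (6 * l); have := divn_eq (y i + 2 * l - t' i) (6 * l).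
  rewrite E; have := ltn_ord (t i); have := ltn_ord (t' i).
  move: (nat_of_ord (t i)) (nat_of_ord (t' i)) (_ %/ _) (_ %/ _) (_ %% _).
  move=> u u' p p' r u'l ul E1 E2.
  have [pp|pp|pp] := ltngtP p p'; last by move: E2 E1; rewrite pp; lia.
  - have : p * (6 * l) + 6 * l <= p' * (6 * l) by rewrite addnC -mulSn leq_mul2r pp orbT.
    lia.
  - have : p' * (6 * l) + 6 * l <= p * (6 * l) by rewrite addnC -mulSn leq_mul2r pp orbT.
    lia.
have -> : l ^ d.+1 = #|[set phi p | p : 'I_l * {ffun 'I_d -> 'I_l}]|.
  by rewrite card_imset // card_prod card_ffun !card_ord expnS.
apply/subset_leq_card/subsetP => k /imsetP[[s t] _ ->]; rewrite inE.
have H i := tstart_cover (tside_bd (phi (s, t))) (yL i) (ltn_ord (t i)).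
have jL i : (y i + 2 * l - t i) %/ (6 * l) < L by case: (H i).
apply/hasP; exists (phi (s, t), [ffun i => Ordinal (jL i)]).
  apply/imageP; exists [ffun i => Ordinal (jL i)] => //; rewrite inE.
  by apply/forallP => i; rewrite !ffunE /=; case: (H i).
apply/in_tcube => i; rewrite !ffunE /=; case: (H i) => _ _; have := xV i.
move: (tside _) (tstart _ _ _) => s' p; rewrite /y; lia.
Qed.

Lemma card_ffun_fix (P : nat) (i : 'I_d) (z : nat) :
  \sum_(k : {ffun 'I_d -> 'I_P}) (val (k i) == z) <= P ^ d.-1.
Proof.
pose F (j : 'I_d) (v : 'I_P) : nat := (j == i) ==> (val v == z).
have -> : \sum_(k : {ffun 'I_d -> 'I_P}) (val (k i) == z) =
    \sum_(k : {ffun 'I_d -> 'I_P}) \prod_j F j (k j).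
  apply: eq_bigr => k _; rewrite (bigD1 i) //= big1 => [|j ji].
    by rewrite muln1 /F eqxx.
  by rewrite /F (negbTE ji).
rewrite -bigA_distr_bigA (bigD1 i) //= -[X in _ <= X]mul1n; apply: leq_mul.
  rewrite /F eqxx /=; have [zP|zP] := ltnP z P.
    rewrite (bigD1 (Ordinal zP)) //= eqxx big1 ?addn0 // => v vz.
    by apply/eqP; rewrite eqb0; apply: contra vz => /eqP vz; apply/eqP/val_inj.
  by rewrite big1 // => v _; apply/eqP; rewrite eqb0; have := ltn_ord v; lia.
rewrite (eq_bigr (fun=> P)) => [|j ji]; last first.
  by rewrite /F (negbTE ji) /= sum1_card card_ord.
by rewrite prod_nat_const cardC1 card_ord.
Qed.

(** A union bound over directions and the four cases of [tstart_bdry]: fixing the side leaves at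
    most [(6 * l) ^ d] families, fixing one offset at most [l * (6 * l) ^ d.-1]. Two of each give
    [14 = 2 * 6 + 2]. *)
Lemma tbdry (x : Zd d) : x \in cube a L ->
  #|[set k : tindex | has (fun b => in_bdry (tcube b) x) (tblocks k)]|
    <= d * (14 * l * (6 * l) ^ d.-1).
Proof.
move=> /in_cube xV.
pose y i := absz (x i - a i)%R.
have yL i : y i < L by have := xV i; rewrite /y; lia.
pose B (k : tindex) i := (tside k == L.-1 - y i) + (tside k == y i) +
  (val (k.2 i) == ((y i).+1 + 2 * l) %% (6 * l)) +
  (val (k.2 i) == (y i - tside k + 2 * l) %% (6 * l)).
apply: (@leq_trans (\sum_(k : tindex) \sum_(i < d) B k i)).
  rewrite -sum1_card big_mkcond; apply: leq_sum => k _; rewrite inE.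
  case: ifP => // /hasP[[k' j] /tblocksP[/= -> ab]] {k'}.
  have s0 : 0 < tside k by have := tside_bd k; lia.
  move=> /(cube_bdry s0)[i xi]; rewrite (bigD1 i) //=; apply: ltn_addr => //.
  have : y i + 1 = tstart (tside k) (k.2 i) (j i) \/
         y i = tstart (tside k) (k.2 i) (j i) + tside k.
    move: xi; rewrite vaddE ffunE /=; have := xV i; rewrite /y.
    by move: (tside k) (tstart _ _ _) => s p; lia.
  rewrite addn1 => /(tstart_bdry (tside_bd k) (ltn_ord _) (yL i) (ab i)).
  by rewrite /B !addn_gt0 !lt0b -!orbA.
have onec (z : nat) : \sum_(k : tindex) (tside k == z) <= (6 * l) ^ d.
  rewrite -(pair_bigA _ (fun s (f : {ffun 'I_d -> 'I_(6 * l)}) => nat_of_bool (l + val s == z))) /=.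
  rewrite (eq_bigr (fun s : 'I_l => (6 * l) ^ d * (l + s == z))) => [|s _]; last first.
    by rewrite sum_nat_const card_ffun !card_ord.
  rewrite -big_distrr -[X in _ <= X]muln1 leq_mul2l /=; apply/orP; right.
  have [zl|zl] := boolP (l <= z < l + l); last first.
    by rewrite big1 // => s _; have := ltn_ord s; move: zl; case: eqP => //; lia.
  have zl' : z - l < l by lia.
  rewrite (bigD1 (Ordinal zl')) //= big1 => [|s sz]; first by case: eqP.
  by apply/eqP; rewrite eqb0; apply: contra sz => /eqP sz; apply/eqP/val_inj => /=; lia.
have onek (i : 'I_d) (z : 'I_l -> nat) :
    \sum_(k : tindex) (val (k.2 i) == z k.1) <= l * (6 * l) ^ d.-1.
  rewrite -(pair_bigA _ (fun s (f : {ffun 'I_d -> 'I_(6 * l)}) => nat_of_bool (val (f i) == z s))) /=.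
  rewrite -[X in _ <= X * _]card_ord -sum_nat_const; apply: leq_sum => s _.
  exact: card_ffun_fix.
rewrite exchange_big /= -[X in _ <= X * _]card_ord -sum_nat_const; apply: leq_sum => i _.
have -> : 14 * l * (6 * l) ^ d.-1 = (6 * l) ^ d + (6 * l) ^ d + l * (6 * l) ^ d.-1 +
    l * (6 * l) ^ d.-1.
  have -> : (6 * l) ^ d = 6 * l * (6 * l) ^ d.-1.
    by rewrite -expnS prednK // (leq_ltn_trans _ (ltn_ord i)).
  move: ((6 * l) ^ d.-1) => z; nia.
rewrite !big_split /=; apply: leq_add; last exact: (onek i (fun s => (y i - (l + s) + 2 * l) %% (6 * l))).
apply: leq_add; last exact: (onek i (fun s => ((y i).+1 + 2 * l) %% (6 * l))).
by apply: leq_add.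
Qed.

Lemma card_tindex : #|{: tindex}| = l * (6 * l) ^ d.
Proof. by rewrite card_prod card_ffun !card_ord. Qed.

End Tiling.

(** * Total influence of a site under exponential decay *)

Section Summability.
Import Order.TTheory GRing.Theory Num.Theory.
Local Open Scope ring_scope.
Variables (R : realType) (th : R).
Hypothesis th0 : 0 < th.
Hypothesis th1 : th < 1.

Lemma sum_geometric_two_sided (n L : nat) :
  \sum_(m < L) th ^+ absz (m%:Z - n%:Z) <= 2 / (1 - th).
Proof.
rewrite ler_pdivlMr ?subr_gt0 // mulr_suml.
(* After multiplication by [1 - th] the partial sums telescope; the bound changes form once [L]
   passes the centre [n]. *)
suff : \sum_(m < L) th ^+ absz (m%:Z - n%:Z) * (1 - th) <=
    if (L <= n)%N then th ^+ (n - L).+1 else 2 - th ^+ (L - n).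
  move/le_trans; apply; case: ifP => _.
    apply: (@le_trans _ _ 1); first by rewrite exprn_ile1 ?ltW.
    by rewrite ler1n.
  by rewrite gerBl exprn_ge0 // ltW.
elim: L => [|L IH].
  by rewrite big_ord0 leq0n exprn_ge0 // ltW.
rewrite big_ord_recr /=; apply: (le_trans (lerD IH (lexx _))).
have [Ln|nL|Ln] := ltngtP L n.
- have -> : absz (L%:Z - n%:Z) = (n - L)%N by lia.
  have -> : (n - L = (n - L.+1).+1)%N by lia.
  by rewrite exprS; lra.
- have -> : absz (L%:Z - n%:Z) = (L - n)%N by lia.
  by rewrite subSn 1?ltnW // exprS; lra.
- rewrite Ln subSn // !subnn subrr expr1 /= expr0 mul1r addrCA subrr addr0 lerBrDr.
  by rewrite (_ : 2 = 1 + 1) ?lerD2l ?ltW // -natr1.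
Qed.

(** The summand is a product over coordinates, so the sum is a product of one-dimensional ones, each
    bounded independently of the side. *)
Lemma sum_l1dist (d : nat) (a : Zd d) (L : nat) (y : Zd d) : y \in cube a L ->
  \sum_(u : seq_sub (cube a L)) th ^+ l1dist (val u) y <= (2 / (1 - th)) ^+ d.
Proof.
move=> /in_cube yV.
rewrite (big_seq_sub +%R (cube a L) xpredT (fun x => th ^+ l1dist x y)).
have uniqc : uniq (cube a L).
  rewrite map_inj_uniq ?enum_uniq // => x x' /ffunP xx; apply/ffunP => i; apply: val_inj.
  by have := xx i; rewrite !vaddE !ffunE => /addrI [].
rewrite undup_id // big_map big_enum /=.
pose n i := absz (y i - a i).
have E (x : {ffun 'I_d -> 'I_L}) : th ^+ l1dist (vadd a [ffun i => Posz (x i)]) y =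
    \prod_i th ^+ absz ((x i)%:Z - (n i)%:Z).
  rewrite /l1dist expr_sum; apply: eq_bigr => i _; rewrite vaddE !ffunE /n.
  by congr (_ ^+ _); have := yV i; lia.
rewrite (eq_bigr _ (fun x _ => E x)).
rewrite -(bigA_distr_bigA (fun i (m : 'I_L) => th ^+ absz (m%:Z - (n i)%:Z))).
rewrite -[X in _ <= _ ^+ X]card_ord -prodr_const; apply: ler_prod => i _.
rewrite sum_geometric_two_sided andbT; apply: sumr_ge0 => m _.
by rewrite exprn_ge0 // ltW.
Qed.

End Summability.

(** * The uniform variance inequality *)

Lemma leq_expl m n e : m <= n -> m ^ e <= n ^ e.
Proof. by case: e => // e mn; rewrite leq_exp2r. Qed.

Section UniformGap.
Import Order.TTheory GRing.Theory Num.Theory.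
Local Open Scope ring_scope.

Variables (R : realType) (d q : nat).
Variables (vw : 'I_q -> R) (ew : 'I_q -> 'I_q -> R).
Hypothesis ew_sym : forall a b, ew a b = ew b a.
Hypothesis vw_gt0 : forall a, 0 < vw a.
Hypothesis ew_ge0 : forall a b, 0 <= ew a b.
Hypothesis q_gt0 : (0 < q)%N.
Local Notation weight := (weight vw ew).
Local Notation w V eta := (wconf vw ew V eta).

Hypothesis Zpos : forall (L : seq (Zd d)) eta, 0 < \sum_(tau : Config L q) weight L (tot eta tau).
Hypothesis irred : forall (L : seq (Zd d)) eta tau tau',
  weight L (tot eta tau) != 0 -> weight L (tot eta tau') != 0 ->
  connect (fun a b : Config L q => [exists v, agr [set v] a b && (weight L (tot eta b) != 0)])
    tau tau'.
Variables (b th : R).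
Hypothesis b_gt0 : 0 < b.
Hypothesis th_gt0 : 0 < th.
Hypothesis th_lt1 : th < 1.
Hypothesis mixing : forall (c : Zd d) (s : nat), (0 < s)%N ->
  forall u, in_bdry (cube c s) u -> forall eta1 eta2,
  (forall x, in_bdry (cube c s) x -> x <> u -> eta1 x = eta2 x) ->
  forall k, \sum_r `|mar (gibbsR vw ew (L := cube c s) eta1)
                        (B := [set v | (k <= l1dist u (val v))%N]) r
                      - mar (gibbsR vw ew eta2) r| <= b * th ^+ k.

Lemma weights_bounded : exists2 H : R, 1 <= H &
  (forall a, bounded_by H 1 (vw a)) /\ (forall a a', ew a a' != 0 -> bounded_by H 1 (ew a a')).
Proof.
pose S1 := \sum_a vw a; pose S2 := \sum_a (vw a)^-1.
pose S3 := \sum_(p : 'I_q * 'I_q) ew p.1 p.2.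
(* Forbidden pairs contribute 0 here, because the inverse of 0 is 0. *)
pose S4 := \sum_(p : 'I_q * 'I_q) (ew p.1 p.2)^-1.
have leS (X : finType) (F : X -> R) x : (forall y, 0 <= F y) -> F x <= \sum_y F y.
  by move=> F0; rewrite (bigD1 x) //= lerDl sumr_ge0.
have S10 : 0 <= S1 by apply: sumr_ge0 => a _; exact: ltW.
have S20 : 0 <= S2 by apply: sumr_ge0 => a _; rewrite invr_ge0 ltW.
have S30 : 0 <= S3 by apply: sumr_ge0.
have S40 : 0 <= S4 by apply: sumr_ge0 => a _; rewrite invr_ge0.
exists (1 + S1 + S2 + S3 + S4); first by lra.
split=> [a|a a' _]; rewrite /bounded_by expr1; apply/andP; split.
- have := leS _ vw a (fun y => ltW (vw_gt0 y)); rewrite -/S1; lra.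
- have H y : 0 <= (vw y)^-1 by rewrite invr_ge0 ltW.
  by have := leS _ _ a H; rewrite -/S2; lra.
- have := leS _ (fun p : 'I_q * 'I_q => ew p.1 p.2) (a, a') (fun p => ew_ge0 p.1 p.2).
  by rewrite -/S3 /=; lra.
- have H : forall p : 'I_q * 'I_q, 0 <= (ew p.1 p.2)^-1 by move=> p; rewrite invr_ge0.
  by have := leS _ _ (a, a') H; rewrite -/S4 /=; lra.
Qed.

(** * The energy inequality in one cube, for a given block scale *)

Section Box.
Variables (a : Zd d) (L l : nat) (eta : Zd d -> 'I_q) (E : {set seq_sub (cube a L)}).
Hypothesis l_gt0 : (0 < l)%N.
Local Notation V := (cube a L).
Local Notation wV := (w V eta).
Local Notation energy f := (nrm wV (f \- hb wV E f) + nrm wV (f \- hb wV (~: E) f)).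
Implicit Types f : Config V q -> R.

Let wV_ge0 (s : Config V q) : 0 <= wV s.
Proof. exact: weight_ge0. Qed.

Lemma energy_sub A f : nrm wV (f \- hb wV (A :&: E) f) + nrm wV (f \- hb wV (A :\: E) f)
  <= energy f.
Proof.
apply: lerD; rewrite !nrm_subhb // lerD2l lerN2; apply: nrm_hb_anti => //.
  exact: subsetIr.
by apply/subsetP => v; rewrite !inE => /andP[].
Qed.

Variables (H : R).
Hypothesis H_ge1 : 1 <= H.
Hypothesis vwH : forall a, bounded_by H 1 (vw a).
Hypothesis ewH : forall a a', ew a a' != 0 -> bounded_by H 1 (ew a a').
Local Notation n := ((2 * l) ^ d)%N.
Local Notation Cl := (energy_const d q H n + 1).

Lemma Cl_ge1 : 1 <= Cl.
Proof. by rewrite lerDr ltW // energy_const_gt0. Qed.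

Lemma cube_energy (c : Zd d) (s : nat) f : {subset cube c s <= V} -> (s <= 2 * l)%N ->
  nrm wV (f \- hb wV (subsites V (cube c s)) f) <= Cl *
  (nrm wV (f \- hb wV (subsites V (cube c s) :&: E) f) +
   nrm wV (f \- hb wV (subsites V (cube c s) :\: E) f)).
Proof.
move=> sV sl; have cardc : (#|{: seq_sub (cube c s)}| <= n)%N.
  by apply: (leq_trans (card_cube c s)); exact: leq_expl.
have := @local_energy R d q vw ew ew_sym vw_gt0 ew_ge0 V (cube c s) eta sV H H_ge1 vwH ewH
  q_gt0 (@irred _) n E cardc f.
move/le_trans; apply; rewrite ler_wpM2r ?addr_ge0 ?nrm_ge0 //.
by rewrite lerDl.
Qed.


(** Such a cube is itself a region of bounded size, and resampling all of it turns a mean-zero [f]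
    into 0. *)
Lemma small_box_energy f : (L < 2 * l)%N -> ip wV (fun=> 1) f = 0 ->
  nrm wV f <= Cl * energy f.
Proof.
move=> Ll f0; have sT : subsites V V = setT.
  by apply/setP => v; rewrite !inE; exact: ssvalP.
have := @cube_energy a L f (fun _ => id) (ltnW Ll); rewrite sT setTI setTD; apply: le_trans.
rewrite nrm_subhb // (_ : nrm wV (hb wV setT f) = 0) ?subr0 // -(@nrm_eqw _ _ _ wV (fun=> 0)).
  by rewrite /nrm /ip big1 // => s _; rewrite !mul0r mulr0.
have all_agr (s : Config V q) : agr setT s =1 xpredT by move=> t; apply/agrP => v; rewrite inE.
move=> s _; rewrite /hb !(eq_bigl _ _ (all_agr s)) (eq_bigr (fun t => wV t * (1 * f t))).
  by rewrite -[\sum_t _]/(ip wV (fun=> 1) f) f0 mul0r.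
by move=> t _; rewrite mul1r.
Qed.

Hypothesis lL : (2 * l <= L)%N.
Local Notation Lam := (fun b : tblock d L l => subsites V (tcube a b)).
Local Notation bd := (fun b : tblock d L l => bdsites V (tcube a b)).
Local Notation N := (fun b : tblock d L l =>
  @hb R _ q (wconf vw ew (tcube a b) eta) (subsites V (tcube a b))).

Let tsub (b : tblock d L l) : {subset tcube a b <= V} := fun x => @tcube_sub d a L l l_gt0 lL b x.

Lemma blocks_far k : {in tblocks L k &, forall i j, i != j -> sepset (@far d V) (Lam i) (Lam j)}.
Proof.
move=> i j ik jk ij; apply/sepsetP => u v; rewrite !inE => ui vj.
exact: (tcube_far l_gt0 lL ik jk ij ui vj).
Qed.

Lemma blocks_disjoint k : {in tblocks L k &, forall i j, i != j ->
  [disjoint Lam i & Lam j] && [disjoint Lam i & bd j]}.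
Proof.
move=> i j ik jk ij; rewrite (sepset_disj (@far_irr d V)) /=; last exact: (blocks_far ik).
apply/pred0P => u /=; apply/negP; rewrite !inE => /andP[ui /andP[_ /hasP[v vj /eqP uv]]].
by have := tcube_far l_gt0 lL ik jk ij ui vj; rewrite uv.
Qed.

(** Transfers the oscillation bounds, proved for the kernels [N] of single small cubes at every
    configuration, to the heat bath on a whole family. *)
Lemma compN_hb k f : eqw wV (compN N (tblocks L k) f) (hb wV (\bigcup_(j <- tblocks L k) Lam j) f).
Proof.
have := tblocks_uniq L k; have := @blocks_far k.
elim: (tblocks L k) => [|j r IH] /=.
  move=> _ _ s ws; rewrite big_nil; apply: esym; apply: hb_const => // t /agrP st _.
  by congr f; apply/ffunP => v; rewrite st ?inE.
move=> sep /andP[jr ur]; rewrite big_cons.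
have {}IH : eqw wV (compN N r f) (hb wV (\bigcup_(j <- r) Lam j) f).
  by apply: IH => // x y xr yr; apply: sep; rewrite inE ?xr ?yr orbT.
have S : sepset (@far d V) (Lam j) (\bigcup_(j <- r) Lam j).
  apply/sepsetP => u v uj; rewrite in_bigcup_seq => /hasP[i ir vi].
  have /sepsetP : sepset (@far d V) (Lam j) (Lam i); last by apply.
  apply: sep; rewrite ?mem_head // ?inE ?ir ?orbT //.
  by apply: contraNneq jr => ->.
apply: eqw_trans (hb_sepU wV_ge0 (@far_irr d V) (fun A B => @exch_far _ _ _ vw ew V eta A B) f S).
move=> s ws; rewrite -(hb_eqw _ IH); apply: esym; exact: (hb_local ew_sym).
Qed.

Lemma avgN_hb f : eqw wV (avgN N (@tblocks d L l) f)
   (avg_hb wV (fun k => \bigcup_(j <- tblocks L k) Lam j) f).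
Proof. by move=> s ws; rewrite /avgN /avg_hb; congr (_ / _); apply: eq_bigr => k _; rewrite compN_hb. Qed.

Lemma iter_avgN_hb m f : eqw wV (iter m (avgN N (@tblocks d L l)) f)
   (iter m (avg_hb wV (fun k => \bigcup_(j <- tblocks L k) Lam j)) f).
Proof.
elim: m => [|m IH] //=; apply: (eqw_trans (avgN_hb _)) => s ws.
by rewrite /avg_hb; congr (_ / _); apply: eq_bigr => k _; rewrite (hb_eqw _ IH).
Qed.

Local Notation G := (b * (2 / (1 - th)) ^+ d).
Local Notation rho := (1 - (2 * 6 ^+ d)^-1 : R).
Hypothesis l_large : (28 * d * 6 ^ d.-1)%:R * G <= l%:R.

Lemma rho_gt0_lt1 : 0 < rho < 1.
Proof.
have H6 : 1 <= 6 ^+ d :> R by rewrite exprn_ege1 // ler1n.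
have : (2 * 6 ^+ d)^-1 <= 2^-1 :> R by rewrite lef_pV2 ?posrE ?mulr_gt0 ?exprn_gt0 //; lra.
have : 0 < (2 * 6 ^+ d)^-1 :> R by rewrite invr_gt0 mulr_gt0 // exprn_gt0.
lra.
Qed.

(** The covering fraction is [l ^ d.+1 / (l * (6 * l) ^ d) = 6 ^ -d], and [l_large] keeps the
    boundary term below half of it. *)
Lemma block_rate : 1 - ((l ^ d.+1)%:R - (d * (14 * l * (6 * l) ^ d.-1))%:R * G) /
   #|{: tindex d l}|%:R <= rho.
Proof.
have lR : 0 < l%:R :> R by rewrite ltr0n.
have Gpos : 0 < G by rewrite mulr_gt0 // exprn_gt0 // divr_gt0 // subr_gt0.
rewrite lerD2l lerN2 card_tindex ler_pdivlMr ?ltr0n ?muln_gt0 ?l_gt0 ?expn_gt0 ?muln_gt0 ?l_gt0 //.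
have -> : (2 * 6 ^+ d)^-1 * (l * (6 * l) ^ d)%:R = l%:R ^+ d.+1 / 2 :> R.
  rewrite natrM natrX natrM exprMn exprS; field.
  by rewrite expf_neq0 ?pnatr_eq0.
have M (g : R) : (d * (14 * l * (6 * l) ^ d.-1))%:R * g = (28 * d * 6 ^ d.-1)%:R * g * l%:R ^+ d / 2.
  case: d => [|d']; first by rewrite !(mul0n, muln0, mul0r).
  have -> : (d'.+1 * (14 * l * (6 * l) ^ d') = d'.+1 * (14 * 6 ^ d') * l ^ d'.+1)%N.
    by rewrite expnMn expnS; lia.
  have -> : (28 * d'.+1 * 6 ^ d' = d'.+1 * (14 * 6 ^ d') * 2)%N by lia.
  by rewrite natrM natrX [X in _ = X * _ * _ / _]natrM; field.
rewrite M natrX; have : (28 * d * 6 ^ d.-1)%:R * G * l%:R ^+ d <= l%:R * l%:R ^+ d.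
  by rewrite ler_wpM2r // exprn_ge0 // ltW.
by rewrite exprS; lra.
Qed.

Lemma large_box_energy f : ip wV (fun=> 1) f = 0 -> (1 - rho) * nrm wV f <=
  \sum_k nrm wV (f \- hb wV (\bigcup_(j <- tblocks L k) Lam j) f).
Proof.
move=> f0; have T0 : (0 < #|{: Config V q}|)%N.
  by rewrite card_ffun card_ord expn_gt0 q_gt0.
have K0 : (0 < #|{: tindex d l}|)%N.
  by rewrite card_tindex muln_gt0 l_gt0 expn_gt0 muln_gt0 l_gt0.
have /andP[rho0 rho1] := rho_gt0_lt1.
apply: avg_hb_variance => //; first by rewrite rho0.
have [c Hc] : exists c, forall n s t, `|iter n (avgN N (@tblocks d L l)) f s -
    iter n (avgN N (@tblocks d L l)) f t| <= c * rho ^+ n.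
  apply: iter_avgN_contr => //; first exact: ltW.
  move=> g D gD; have D0 : 0 <= \sum_u D u.
    by case/card_gt0P: T0 => t0 _; apply: sumr_ge0 => u _; exact: lip_ge0 t0 gD.
  pose infl (u v : seq_sub V) : R := b * th ^+ l1dist (val u) (val v).
  have infl0 u v : 0 <= infl u v by rewrite mulr_ge0 ?exprn_ge0 // ltW.
  have lipN j g' D' : lip g' D' -> lip (N j g') (fun u => (u \notin Lam j)%:R * D' u +
      (u \in bd j)%:R * \sum_(v in Lam j) infl u v * D' v).
    apply: (@lip_hb_local R d q vw ew vw_gt0 ew_ge0 V (tcube a j) eta (@tsub j) _
      (fun k => b * th ^+ k)) => // u ub eta1 eta2 e12 k.
    apply: mixing => //; by case/andP: (tside_bd l_gt0 lL j.1) => /(leq_trans l_gt0).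
  have [] := @avgN_contr R _ q _ N Lam bd infl infl0 lipN _ (@tblocks d L l)
    (l ^ d.+1) (d * (14 * l * (6 * l) ^ d.-1)) G g D T0 K0 (@tblocks_uniq d L l)
    (@blocks_disjoint) _ _ _ gD.
  - move=> u; apply: (leq_trans (tcover l_gt0 lL (ssvalP u))); apply: subset_leq_card.
    apply/subsetP => k; rewrite !inE in_bigcup_seq => /hasP[j jk uj].
    by apply/hasP; exists j => //; rewrite inE.
  - move=> u; apply: leq_trans (tbdry l_gt0 lL (ssvalP u)); apply: subset_leq_card.
    apply/subsetP => k; rewrite !inE in_bigcup_seq => /hasP[j jk uj].
    by apply/hasP; exists j => //; rewrite inE in uj.
  - by move=> v; rewrite -mulr_sumr ler_wpM2l ?sum_l1dist // ?ltW //; exact: ssvalP.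
  move=> D' gD' sD'; exists D' => //; apply: (le_trans sD').
  by rewrite ler_wpM2r // block_rate.
by exists c => m s t ws wt; rewrite -!iter_avgN_hb.
Qed.

(** The local energy inequality becomes a scan contraction with constant [(3 * Cl)^-1], extends to
    each family by tensorization, and returns to energies at the cost of another 3; the sum over
    families gives [#|{: tindex d l}|]. *)
Lemma box_energy f : ip wV (fun=> 1) f = 0 ->
  (1 - rho) / (3 * Cl) * nrm wV f <= 3 * #|{: tindex d l}|%:R * energy f.
Proof.
move=> f0; have C1 := Cl_ge1; have C0 : 0 < 3 * Cl by lra.
have c01 : 0 <= (3 * Cl)^-1 <= 1.
  by rewrite invr_ge0 ltW //= invf_le1 //; lra.
have exchV A B : sepset (@far d V) A B -> exch wV A B by exact: exch_far.
have sc k : scan_contr wV E (3 * Cl)^-1 (\bigcup_(j <- tblocks L k) Lam j).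
  apply: (scan_contr_bigU wV_ge0 (@far_irr d V) exchV c01 (tblocks_uniq L k) (@blocks_far k)).
  move=> j jk; apply: (scan_contr_of_energy wV_ge0); first by lra.
  move=> g; apply: cube_energy; first exact: tsub.
  by case/andP: (tside_bd l_gt0 lL j.1) => _ /ltnW.
have en k : (3 * Cl)^-1 * nrm wV (f \- hb wV (\bigcup_(j <- tblocks L k) Lam j) f) <=
    3 * energy f.
  apply: (le_trans (energy_of_scan_contr wV_ge0 f (sc k))).
  by rewrite ler_pM2l // energy_sub.
rewrite mulrAC [X in X <= _]mulrC.
apply: (le_trans (ler_wpM2l (proj1 (andP c01)) (large_box_energy f0))).
rewrite mulr_sumr; apply: (le_trans (ler_sum _ (fun k _ => en k))).
by rewrite sumr_const -[X in X <= _]mulr_natl mulrCA mulrA.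
Qed.

End Box.

Theorem uniform_scan_contraction : exists2 c : R, 0 < c < 1 &
  forall (a : Zd d) (L : nat) eta (E : {set seq_sub (cube a L)}) f,
    ip (w (cube a L) eta) (fun=> 1) f = 0 ->
    nrm (w (cube a L) eta) (hb (w (cube a L) eta) (~: E) (hb (w (cube a L) eta) E f))
      <= (1 - c) * nrm (w (cube a L) eta) f.
Proof.
have [H H1 [vwH ewH]] := weights_bounded.
pose G := b * (2 / (1 - th)) ^+ d.
(* This scale depends only on [d], [b] and [th], so the constants below are the same for all cubes
   and boundary conditions. *)
pose l := (Num.bound ((28 * d * 6 ^ d.-1)%:R * G)).+1.
have G0 : 0 <= G by rewrite ltW // mulr_gt0 // exprn_gt0 // divr_gt0 // subr_gt0.
have ll : (28 * d * 6 ^ d.-1)%:R * G <= l%:R.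
  have : 0 <= (28 * d * 6 ^ d.-1)%:R * G by rewrite mulr_ge0.
  by move=> /archi_boundP /ltW /le_trans; apply; rewrite ler_nat.
pose Cl := energy_const d q H ((2 * l) ^ d) + 1.
have C1 : 1 <= Cl by rewrite lerDr ltW // energy_const_gt0.
pose r : R := (2 * 6 ^+ d)^-1.
have r0 : 0 < r by rewrite invr_gt0 mulr_gt0 // exprn_gt0.
have p0 : 0 < r / (3 * Cl) by rewrite divr_gt0 //; lra.
have P0 : 0 <= 3 * #|{: tindex d l}|%:R / (r / (3 * Cl)).
  by apply: divr_ge0; [rewrite mulr_ge0|exact: ltW].
(* The sum of the constants for cubes of side at least [2 * l] and for smaller ones; the 3 in
   [(3 * M)^-1] is that of [scan_energy]. *)
pose M := 3 * #|{: tindex d l}|%:R / (r / (3 * Cl)) + Cl.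
have M1 : 1 <= M.
  by apply: (le_trans C1); rewrite lerDr.
exists (3 * M)^-1.
  by rewrite invr_gt0 mulr_gt0 //= ?invf_lt1; lra.
move=> a L eta E f f0; set wV := wconf _ _ _ _.
have wV0 s : 0 <= wV s by exact: weight_ge0.
pose en := nrm wV (f \- hb wV E f) + nrm wV (f \- hb wV (~: E) f).
have en0 : 0 <= en by rewrite addr_ge0 ?nrm_ge0.
have Hen : nrm wV f <= M * en.
  have [Ll|Ll] := ltnP L (2 * l).
    have := @small_box_energy a L l eta E H H1 vwH ewH f Ll f0.
    by move/le_trans; apply; rewrite -/wV -/en -/Cl ler_wpM2r // lerDr P0.
  have := @box_energy a L l eta E (ltn0Sn _) H H1 vwH ewH Ll ll f f0.
  rewrite -/wV -/en -/Cl subKr -/r => BE.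
  rewrite /M mulrDl; apply: ler_wpDr; first by rewrite mulr_ge0 //; lra.
  by rewrite mulrAC ler_pdivlMr // mulrC.
have := scan_energy wV0 E setT f; rewrite setTI setTD -/en /scan setTI setTD => SE.
have M0 : 0 < 3 * M by lra.
have X : nrm wV f <= 3 * M * (nrm wV f - nrm wV (hb wV (~: E) (hb wV E f))).
  apply: (le_trans Hen); rewrite [3 * M]mulrC -mulrA ler_wpM2l //; lra.
rewrite -ler_pdivrMl // in X; lra.
Qed.

End UniformGap.

(** * Eigenvalues *)

Section Eigenvalues.
Import Order.TTheory GRing.Theory Num.Theory.
Local Open Scope ring_scope.

Variables (R : realType) (I : finType) (q : nat).
Notation T := {ffun I -> 'I_q}.
Variable w : T -> R.
Hypothesis w_ge0 : forall s, 0 <= w s.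
Variable E : {set I}.
Local Notation sweep f := (hb w E (hb w (~: E) (hb w E f))).

Lemma nrm_eq0 (f : T -> R) : nrm w f = 0 -> eqw w f (fun=> 0).
Proof.
move=> f0 s ws; have pos (t : T) : true -> 0 <= w t * (f t * f t).
  by rewrite mulr_ge0 // -expr2 sqr_ge0.
have /eqP := psumr_eq0P pos f0 isT (i := s).
by rewrite mulf_eq0 (negbTE ws) /= mulf_eq0 orbb => /eqP.
Qed.

(** The sweep is the adjoint of [hb (~: E)] after [hb E] composed with that operator, so its
    quadratic form is nonnegative and no eigenvalue is negative. *)
Lemma ip_sweep (f : T -> R) : ip w f (sweep f) = nrm w (hb w (~: E) (hb w E f)).
Proof. by rewrite hb_adj nrm_hb. Qed.

Lemma ip1_sweep (f : T -> R) : ip w (fun=> 1) (sweep f) = ip w (fun=> 1) f.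
Proof.
have ip1 A g : ip w (fun=> 1) (hb w A g) = ip w (fun=> 1) g.
  by rewrite hb_adj; apply: ip_eqw => // s ws; exact: hb_const.
by rewrite !ip1.
Qed.

Variables (c : R) (N : nat) (l : nat -> R) (f : nat -> T -> R).
Hypothesis c_gt0 : 0 < c.
Hypothesis contr : forall g : T -> R, ip w (fun=> 1) g = 0 ->
  nrm w (hb w (~: E) (hb w E g)) <= (1 - c) * nrm w g.
Hypothesis l_sorted : forall i j, (i <= j < N)%N -> l j <= l i.
Hypothesis eigen : forall i, (i < N)%N -> eqw w (sweep (f i)) (fun s => l i * f i s).
Hypothesis indep : forall a : nat -> R,
  (forall s, w s != 0 -> \sum_(i < N) a i * f i s = 0) -> forall i, (i < N)%N -> a i = 0.

Lemma eigenvector_gt0 i : (i < N)%N -> 0 < nrm w (f i).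
Proof.
move=> iN; rewrite lt_def nrm_ge0 // andbT; apply/eqP => /nrm_eq0 fi0.
suff : (i == i)%:R = 0 :> R by rewrite eqxx => /eqP; rewrite oner_eq0.
apply: (@indep (fun j => (j == i)%:R) _ i iN) => s ws; rewrite (bigD1 (Ordinal iN)) //= fi0 // mulr0 add0r big1 // => j.
by rewrite -val_eqE /= => /negbTE ->; rewrite mul0r.
Qed.

Lemma eigenvalue_energy i : (i < N)%N ->
  l i * nrm w (f i) = nrm w (hb w (~: E) (hb w E (f i))).
Proof.
by move=> iN; rewrite -ip_sweep (ip_eqw (fun _ _ => erefl) (eigen iN)) ipZr.
Qed.

Lemma eigenvalue_ge0 i : (i < N)%N -> 0 <= l i.
Proof.
move=> iN; rewrite -(pmulr_lge0 _ (eigenvector_gt0 iN)) eigenvalue_energy //.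
exact: nrm_ge0.
Qed.

Lemma eigenvalue_mean i : (i < N)%N -> ip w (fun=> 1) (f i) = 0 -> l i <= 1 - c.
Proof.
move=> iN /contr; rewrite -eigenvalue_energy // ler_pM2r //; exact: eigenvector_gt0.
Qed.

(** The sweep preserves means, so an eigenvector of nonzero mean has eigenvalue 1. If [f 0] and
    [f 1] both have nonzero mean, a combination of them is a mean-zero fixed point, which the
    contraction forces to vanish, against independence. Otherwise one of them has mean zero, and
    sorting gives the bound. *)
Lemma second_eigenvalue : (1 < N)%N -> l 1%N <= 1 - c.
Proof.
move=> N1; have N0 : (0 < N)%N by exact: ltnW.
have mean i : (i < N)%N -> l i * ip w (fun=> 1) (f i) = ip w (fun=> 1) (f i).
  by move=> iN; rewrite -[RHS]ip1_sweep (ip_eqw (fun _ _ => erefl) (eigen iN)) ipZr.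
have [m1|m1] := eqVneq (ip w (fun=> 1) (f 1%N)) 0; first exact: eigenvalue_mean.
have l1 : l 1%N = 1 by apply: (mulIf m1); rewrite mean // mul1r.
have [m0|m0] := eqVneq (ip w (fun=> 1) (f 0%N)) 0.
  by apply: le_trans (eigenvalue_mean N0 m0); apply: l_sorted.
have l0 : l 0%N = 1 by apply: (mulIf m0); rewrite mean // mul1r.
pose x0 := ip w (fun=> 1) (f 0%N); pose x1 := ip w (fun=> 1) (f 1%N).
pose g s := x1 * f 0%N s - x0 * f 1%N s.
have gS : eqw w (sweep g) g.
  have gE : g = (fun s => x1 * f 0%N s) \- (fun s => x0 * f 1%N s) by [].
  have hbZ A x h : hb w A (fun s => x * h s) = (fun s => x * hb w A h s).
    apply: funext => s; rewrite /hb mulrA mulr_sumr; congr (_ / _).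
    by apply: eq_bigr => t _; rewrite mulrCA.
  move=> s ws; rewrite gE !hbB !hbZ /= !eigen // l0 l1 !mul1r.
  by [].
have g0 : ip w (fun=> 1) g = 0.
  have -> : g = (fun s => x1 * f 0%N s) \- (fun s => x0 * f 1%N s) by [].
  by rewrite ipBr !ipZr -/x0 -/x1; ring.
have gn : nrm w g = 0.
  have := contr g0; rewrite -ip_sweep (ip_eqw (fun _ _ => erefl) gS) -/(nrm w g).
  have := nrm_ge0 w_ge0 g; move: (nrm w g) => z z0 H.
  apply/eqP; rewrite eq_le z0 andbT -(pmulr_rle0 _ c_gt0); lra.
pose coef i := if i is 0%N then x1 else if i is 1%N then - x0 else 0.
suff /eqP : coef 0%N = 0 by rewrite (negbTE m1).
apply: (@indep coef _ 0%N N0) => s ws; have := nrm_eq0 gn ws; rewrite /g => gs.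
rewrite (bigD1 (Ordinal N0)) //= (bigD1 (Ordinal N1)) //= big1 => [|i].
  by rewrite addr0 mulNr.
by case: i => -[|[|i]] iN /andP[] //; rewrite ?mul0r.
Qed.

End Eigenvalues.

(** * The theorem over the Stdlib reals *)

From Stdlib Require Import Reals.

Section Bridge.
Import Order.TTheory GRing.Theory Num.Theory.
Local Open Scope ring_scope.
Local Notation R := Rdefinitions.R.

Variables (d q : nat) (U : 'I_q -> 'I_q -> option R) (W : 'I_q -> R).
Local Notation vw := (fun a => exp (W a)).
Local Notation psi eta := (fun x => Some (eta x)).
Implicit Types (V : seq (Zd d)) (eta : Zd d -> 'I_q).

Lemma posbE (x : R) : posb x = (0 < x).
Proof. rewrite /posb; case: Rlt_dec => H; apply: esym; first exact/RltP.
by apply/negP => /RltP. Qed.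

Lemma ew_ge0 a b : 0 <= ew U a b.
Proof. by rewrite /ew; case: (U a b) => [x|]; apply/RleP; [left; exact: exp_pos|right]. Qed.

Lemma vw_gt0 a : 0 < vw a.
Proof. by apply/RltP; exact: exp_pos. Qed.

Lemma gweightE V eta (s : Config V q) :
  gweight U W (psi eta) s = weight vw (ew U) V (tot eta s).
Proof.
rewrite /gweight /weight; apply: eq_bigr => v _; rewrite /site_weight tot_val.
congr (_ * _); apply: eq_bigr => i _.
have extE x : ext (psi eta) s x = Some (tot eta s x) by rewrite /ext /tot; case: insub.
rewrite extE /=; congr (_ * _); case: ifP => // /negbT nV.
by rewrite /= tot_out.
Qed.

Lemma validE V eta (s : Config V q) :
  valid U W (psi eta) s = (wconf vw (ew U) V eta s != 0).
Proof.
by rewrite /valid posbE gweightE lt_def weight_ge0 ?andbT //; [exact: vw_gt0|exact: ew_ge0].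
Qed.

Lemma KmatE V eta (A : {set seq_sub V}) (s t : Config V q) :
  Kmat U W (psi eta) A s t = if agr A s t then wconf vw (ew U) V eta t /
    \sum_(r | agr A s r) wconf vw (ew U) V eta r else 0.
Proof.
rewrite /Kmat -[agree_off A s t]/(agr A s t); case: ifP => // _.
rewrite gweightE; set Z := bigop _ _ _.
have -> : Z = \sum_(r | agr A s r) wconf vw (ew U) V eta r.
  by rewrite /Z; apply: eq_bigr => r _; exact: gweightE.
by rewrite RdivE.
Qed.

(** The sum runs over valid configurations, as in [mprod] and [eigendecomp]. *)
Definition kact V eta (P : Config V q -> Config V q -> R) (f : Config V q -> R) s : R :=
  \sum_(t | valid U W (psi eta) t) P s t * f t.

(** Restricting to valid [t] drops only terms of weight zero, so this is an equality at every
    configuration. *)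
Lemma kact_Kmat V eta (A : {set seq_sub V}) f :
  kact eta (Kmat U W (psi eta) A) f = hb (wconf vw (ew U) V eta) A f.
Proof.
apply: funext => s; rewrite /kact /hb big_mkcond mulr_suml [RHS]big_mkcond.
apply: eq_bigr => t _; rewrite KmatE validE.
have [->|wt] := eqVneq (wconf vw (ew U) V eta t) 0; first by rewrite !mul0r; case: ifP.
by case: ifP; rewrite ?mul0r // mulrAC.
Qed.

Lemma kact_mprod V eta (P Q : Config V q -> Config V q -> R) f :
  kact eta (mprod U W (psi eta) P Q) f = kact eta P (kact eta Q f).
Proof.
apply: funext => s; rewrite /kact.
transitivity (\sum_(t | valid U W (psi eta) t) \sum_(u | valid U W (psi eta) u)
   P s u * Q u t * f t).
  by apply: eq_bigr => t _; rewrite -mulr_suml.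
rewrite exchange_big; apply: eq_bigr => u _; rewrite mulr_sumr.
by apply: eq_bigr => t _; rewrite mulrA.
Qed.

Lemma kact_SEOE V eta f : kact eta (SEOE U W (psi eta)) f =
  hb (wconf vw (ew U) V eta) (Veven V) (hb (wconf vw (ew U) V eta) (~: Veven V)
    (hb (wconf vw (ew U) V eta) (Veven V) f)).
Proof.
rewrite /SEOE !kact_mprod !kact_Kmat; congr (hb _ _ (hb _ _ _)).
by apply/setP => v; rewrite !inE negbK.
Qed.

Lemma exp_INR (a : R) k : exp (- (a * INR k)) = exp (- a) ^+ k.
Proof.
elim: k => [|k IH]; first by rewrite expr0 /= Rmult_0_r Ropp_0 exp_0.
rewrite exprS -IH -[RHS]exp_plus; congr exp; rewrite S_INR; ring.
Qed.


Lemma permissive_q_gt0 : permissive d U W -> (0 < q)%nat.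
Proof.
move=> perm; have [s _] := perm [:: [ffun=> Posz 0]] (fun=> None).
exact: leq_ltn_trans (leq0n _) (ltn_ord (s (SeqSub (mem_head _ _)))).
Qed.

Lemma weight_sum_gt0 : permissive d U W ->
  forall V eta, 0 < \sum_(tau : Config V q) weight vw (ew U) V (tot eta tau).
Proof.
move=> perm V eta; have [s /RltP] := perm V (psi eta); rewrite gweightE => s0.
rewrite (bigD1 s) //= ltr_wpDr //; apply: sumr_ge0 => t _.
by apply: weight_ge0; [exact: vw_gt0|exact: ew_ge0].
Qed.

Lemma glauber_connect : glauber_irreducible d U W -> forall V eta (s t : Config V q),
  weight vw (ew U) V (tot eta s) != 0 -> weight vw (ew U) V (tot eta t) != 0 ->
  connect (fun a b : Config V q =>
    [exists v, agr [set v] a b && (weight vw (ew U) V (tot eta b) != 0)]) s t.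
Proof.
move=> irr V eta s t s0 t0; have := irr V (psi eta) s t; rewrite !validE => /(_ s0 t0).
apply: connect_sub => a b /existsP[v]; rewrite posbE KmatE => ab; apply: connect1.
apply/existsP; exists v; move: ab; case: ifP => _; last by rewrite ltxx.
by move=> ab /=; apply: contraTneq ab => b0; rewrite /wconf b0 mul0r ltxx.
Qed.

Lemma gibbs_gibbsR V eta (s : Config V q) :
  gibbs U W (psi eta) s = gibbsR vw (ew U) eta s.
Proof.
rewrite /gibbs gweightE RdivE /Zpart /gibbsR; congr (_ / _).
by apply: eq_bigr => r _; exact: gweightE.
Qed.

Lemma marg_l1E V eta1 eta2 (B : {set seq_sub V}) :
  marg_l1 U W (psi eta1) (psi eta2) B =
  \sum_r `|mar (gibbsR vw (ew U) eta1) (B := B) r - mar (gibbsR vw (ew U) eta2) r|.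
Proof.
rewrite /marg_l1; apply: eq_bigr => r _; rewrite RabsE; congr (`|_|).
by rewrite /marg /mar; congr (_ - _); apply: eq_bigr => s _; exact: gibbs_gibbsR.
Qed.

Lemma scan_contraction : (forall a b, U a b = U b a) -> permissive d U W ->
  glauber_irreducible d U W -> SSM d U W -> exists2 c : R, 0 < c < 1 &
  forall (x : Zd d) (L : nat) eta f,
    ip (wconf vw (ew U) (cube x L) eta) (fun=> 1) f = 0 ->
    nrm (wconf vw (ew U) (cube x L) eta) (hb (wconf vw (ew U) (cube x L) eta)
      (~: Veven (cube x L)) (hb (wconf vw (ew U) (cube x L) eta) (Veven (cube x L)) f))
    <= (1 - c) * nrm (wconf vw (ew U) (cube x L) eta) f.
Proof.
move=> Usym perm irr [a [b [/RltP a0 [/RltP b0 ssm]]]].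
have ew_sym s t : ew U s t = ew U t s by rewrite /ew Usym.
have th0 : 0 < exp (- a) by apply/RltP; exact: exp_pos.
have th1 : exp (- a) < 1.
  by rewrite -[X in _ < X]exp_0; apply/RltP/exp_increasing/RltP; rewrite oppr_lt0.
(* Strong spatial mixing is applied to the sites at distance at least [k] from [u], with
   [th = exp (- a)]. *)
have mixing (c : Zd d) (s : nat) : (0 < s)%nat ->
  forall u, in_bdry (cube c s) u -> forall eta1 eta2 : Zd d -> 'I_q,
  (forall x, in_bdry (cube c s) x -> x <> u -> eta1 x = eta2 x) ->
  forall k, \sum_r `|mar (gibbsR vw (ew U) (L := cube c s) eta1)
      (B := [set v | (k <= l1dist u (val v))%nat]) r - mar (gibbsR vw (ew U) eta2) r|
    <= b * exp (- a) ^+ k.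
  move=> s0 u ub eta1 eta2 e12 k; rewrite -marg_l1E -exp_INR; apply/RleP.
  by apply: (ssm c s s0 _ u ub eta1 eta2 e12 k) => v; rewrite inE.
have [c c01 H] := uniform_scan_contraction ew_sym vw_gt0 ew_ge0 (permissive_q_gt0 perm)
  (weight_sum_gt0 perm) (glauber_connect irr) b0 th0 th1 mixing.
by exists c => // x L eta f; exact: H.
Qed.

(** Nonnegative sorted eigenvalues reduce the maximum in [gap] to [l 1]; with [N < 2] the gap is 1
    by convention. *)
Lemma gap_bounds (c : R) (x : Zd d) (L : nat) eta N l (f : nat -> Config (cube x L) q -> R) :
  0 < c < 1 ->
  (forall g, ip (wconf vw (ew U) (cube x L) eta) (fun=> 1) g = 0 ->
    nrm (wconf vw (ew U) (cube x L) eta) (hb (wconf vw (ew U) (cube x L) eta)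
      (~: Veven (cube x L)) (hb (wconf vw (ew U) (cube x L) eta) (Veven (cube x L)) g))
    <= (1 - c) * nrm (wconf vw (ew U) (cube x L) eta) g) ->
  eigendecomp (valid U W (psi eta)) (SEOE U W (psi eta)) N l f -> c <= gap N l <= 1.
Proof.
move=> /andP[c0 c1] contr [_ [sorted [eig ind]]].
have w_ge0 (s : Config (cube x L) q) : 0 <= wconf vw (ew U) (cube x L) eta s.
  by apply: weight_ge0; [exact: vw_gt0|exact: ew_ge0].
have srt i j : (i <= j < N)%nat -> l j <= l i by move=> ij; apply/RleP; exact: sorted.
have eigen i : (i < N)%nat -> eqw (wconf vw (ew U) (cube x L) eta)
   (hb (wconf vw (ew U) (cube x L) eta) (Veven (cube x L)) (hb (wconf vw (ew U) (cube x L) eta)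
     (~: Veven (cube x L)) (hb (wconf vw (ew U) (cube x L) eta) (Veven (cube x L)) (f i))))
   (fun s => l i * f i s).
  by move=> iN s ws; rewrite -kact_SEOE; apply: (eig i iN s); rewrite validE.
have indep (k : nat -> R) : (forall s, wconf vw (ew U) (cube x L) eta s != 0 ->
    \sum_(i < N) k i * f i s = 0) -> forall i, (i < N)%nat -> k i = 0.
  by move=> H; apply: ind => s; rewrite validE; exact: H.
rewrite /gap; case: ifP => N2; last by rewrite (ltW c1) lexx.
have l1 := second_eigenvalue w_ge0 c0 contr srt eigen indep N2.
have l1_ge0 := eigenvalue_ge0 w_ge0 eigen indep N2.
have NN : (N - 1 < N)%nat by rewrite subn1 prednK // ltnW.
have lN_ge0 := eigenvalue_ge0 w_ge0 eigen indep NN.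
have lN : l (N - 1)%nat <= l 1%nat by apply: srt; rewrite NN andbT subn_gt0 in N2 *.
rewrite !RabsE !ger0_norm // RmaxE max_l //.
have -> : Rminus 1 (l 1%nat) = 1 - l 1%nat by [].
by rewrite lerBrDr gerBl l1_ge0 andbT -lerBrDl.
Qed.

(** The relaxation time decreases in the gap, and [0 < c] keeps both denominators positive. *)
Lemma relaxation_time_bound (c g : R) : 0 < c < 1 -> c <= g <= 1 ->
  Rle (Rinv (1 - sqrt (1 - g))) (Rinv (1 - sqrt (1 - c))).
Proof.
move=> /andP[c0 c1] /andP[cg g1]; rewrite !RsqrtE; apply/RleP.
have s1 : Num.sqrt (1 - c) < 1.
  by rewrite -[X in _ < X]sqrtr1 ltr_sqrt // gtrBl.
have sg : Num.sqrt (1 - g) <= Num.sqrt (1 - c) by rewrite ler_wsqrtr // lerB.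
by rewrite lef_pV2 ?posrE ?subr_gt0 ?lerB // (le_lt_trans sg).
Qed.

End Bridge.

Local Open Scope R_scope.

Theorem mainTheorem14 (d q : nat) (U : 'I_q -> 'I_q -> option R) (W : 'I_q -> R) :
  (forall s t, U s t = U t s) ->
  @permissive d q U W -> @glauber_irreducible d q U W -> @SSM d q U W ->
  exists c : R, 0 < c /\
  exists C : R,
  forall (a : Zd d) (L : nat), (0 < L)%nat ->
  forall (eta : Zd d -> 'I_q) (N : nat) (l : nat -> R) (f : nat -> Config (cube a L) q -> R),
    eigendecomp (valid U W (fun x => Some (eta x)))
                (SEOE U W (fun x => Some (eta x))) N l f ->
    c <= gap N l /\ / (1 - sqrt (1 - gap N l)) <= C.
Proof.
move=> Usym perm irr ssm; have [c c01 contr] := scan_contraction Usym perm irr ssm.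
exists c; split; first by apply/RltP; case/andP: c01.
exists (/ (1 - sqrt (1 - c))) => a L L0 eta N l f dec.
have g01 := gap_bounds c01 (contr a L eta) dec.
split; first by apply/RleP; case/andP: g01.
exact: relaxation_time_bound c01 g01.
Qed.
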